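(* Let $a>0$, $y\in\mathbb{C}$, $q\in(0,1)\cup\mathbb{N}$, and let $\delta,\lambda,\mu,v,\gamma\in\mathbb{C}$ satisfy $\Re(\delta)\ge 0$, $\Re(v)>-1$, $\Re(\gamma)\ge 0$, $\gamma\neq 0$, $\Re(\delta)-q>-1$ and $0<\Re(\mu)<\Re(\lambda)$. Then $$\int_{0}^{\infty }x^{\mu -1}\left( x+a+\sqrt{x^{2}+2ax}\right)^{-\lambda } J_{v,q}^{\delta ,\gamma }\left( \frac{y}{x+a+\sqrt{x^{2}+2ax}}\right) dx = \frac{\Gamma(2\mu)}{\Gamma(\gamma)}\,a^{\mu-\lambda}\,2^{1-\mu}\; {}_{3}\Psi_{3}\left[ \begin{array}{c} (\gamma ,q),\ (\lambda +1,1),\ (\lambda -\mu,1); \\ (v+1,\delta),\ (1+\lambda+\mu ,1),\ (\lambda ,1); \end{array} -\frac{y}{a}\right].$$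
   Context: The generalized Bessel-Maitland function is defined by $J_{v,q}^{\delta,\gamma}(z)=\sum_{n=0}^{\infty}\frac{(\gamma)_{qn}(-z)^n}{n!\,\Gamma(\delta n+v+1)}$, where $(\gamma)_0=1$ and $(\gamma)_{qn}=\frac{\Gamma(\gamma+qn)}{\Gamma(\gamma)}$. The generalized Wright hypergeometric function is the series ${}_{p}\Psi_{r}\left[\begin{array}{c}(a_1,\alpha_1),\dots,(a_p,\alpha_p);\\ (b_1,\beta_1),\dots,(b_r,\beta_r);\end{array} z\right]=\sum_{k=0}^{\infty}\frac{\prod_{i=1}^{p}\Gamma(a_i+\alpha_i k)}{\prod_{j=1}^{r}\Gamma(b_j+\beta_j k)}\frac{z^k}{k!}$. Here $1/\Gamma$ is the entire reciprocal Gamma function, and powers of positive reals with complex exponents are the principal ones. *)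

(* Defs.v *)
From Stdlib Require Import Reals List Factorial.
From Coquelicot Require Import Coquelicot.

Open Scope R_scope.
Open Scope C_scope.

Definition cexp (z : C) : C :=
  RtoC (exp (Re z)) * (cos (Im z), sin (Im z)).

(** Principal value of [x ^ s]; meaningful only for [0 < x]. *)
Definition cpower (x : R) (s : C) : C := cexp (s * RtoC (ln x)).

Definition clim_seq (u : nat -> C) : C :=
  (real (Lim_seq (fun n => Re (u n))), real (Lim_seq (fun n => Im (u n)))).

Definition cseries (u : nat -> C) : C :=
  clim_seq (sum_n (G := C_AbelianMonoid) u).

(** [rising z n = z (z + 1) ... (z + n - 1)]. *)
Fixpoint rising (z : C) (n : nat) : C :=
  match n with
  | O => 1
  | S m => rising z m * (z + INR m)
  end.

(** The entire function [1 / Gamma], by Gauss's formula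
    [1 / Gamma z = lim z (z + 1) ... (z + n) / (n! n ^ z)], whose limit exists
    for every complex [z]. *)
Definition rGamma (z : C) : C :=
  clim_seq (fun n => rising z (S n) / (INR (fact n) * cpower (INR n) z)).

(** Meaningful away from the poles [0, -1, -2, ...]. *)
Definition Gamma (z : C) : C := / rGamma z.

(** The generalized Pochhammer symbol [(g)_s]. *)
Definition pochhammer (g : C) (s : R) : C :=
  if Req_EM_T s 0 then 1 else Gamma (g + s) / Gamma g.

Definition bessel_maitland_term (v delta gamma : C) (q : R) (z : C)
    (n : nat) : C :=
  pochhammer gamma (q * INR n)%R * (- z) ^ n / INR (fact n)
  * rGamma (delta * INR n + v + 1).

Definition bessel_maitland (v delta gamma : C) (q : R) (z : C) : C :=
  cseries (bessel_maitland_term v delta gamma q z).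

Definition cprod (l : list C) : C := fold_right Cmult 1 l.

(** The parameters [(a_i, alpha_i)] and [(b_j, beta_j)] of the Wright function
    are the elements of [num] and [den]. *)
Definition wright_term (num den : list (C * C)) (z : C) (k : nat) : C :=
  cprod (map (fun p => Gamma (fst p + snd p * INR k)) num)
  * cprod (map (fun p => rGamma (fst p + snd p * INR k)) den)
  * (z ^ k / INR (fact k)).

Definition wright (num den : list (C * C)) (z : C) : C :=
  cseries (wright_term num den z).

(* Main.v *)
Require Import Defs.
From Stdlib Require Import Reals List Factorial Lra Lia.
From Coquelicot Require Import Coquelicot.
Import ListNotations.
Open Scope R_scope.
Open Scope C_scope.

(** The integral is evaluated term by term.  Put
    [w x = x + a + sqrt (x ^ 2 + 2 a x)].  The substitution [t = a / w x] maps
    [(0, +oo)] onto [(0, 1)] and rationalises the square root: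
    [x = (a / 2) (1 - t) ^ 2 / t].  It turns the integral into
    [(a / 2) ^ mu * a ^ (- lambda)] times the integral over the unit interval of
    [(1 - t) ^ (2 mu - 1) (1 + t) t ^ (lambda - mu - 1) * sum_n e_n t ^ n],
    where [e_n] is the [n]-th term of the Bessel-Maitland series at [y / a].
    Splitting [1 + t], the [n]-th moment of the kernel is a sum of two Beta
    integrals,
    [B (2 mu, lambda - mu + n) + B (2 mu, lambda - mu + n + 1)
     = 2 (lambda + n) Gamma (2 mu) Gamma (lambda - mu + n)
       / Gamma (1 + lambda + mu + n)],
    and writing [lambda + n] as [Gamma (lambda + 1 + n) / Gamma (lambda + n)]
    makes [e_n] times this moment a constant multiple of the [n]-th term of the
    Wright series.

    Three facts support this computation.  First, Gauss's limit exists, and it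
    is nonzero when [Re z >= 0] and [z <> 0] ([gauss_cvg], [rGamma_neq0]), because
    consecutive terms have a ratio [1 + O (1 / n ^ 2)], and so have their
    inverses.  Secondly, Euler's formula for the Beta integral holds for complex
    parameters ([Beta_Gamma]): the recurrence [z B (z) = (z + al) B (z + 1)],
    obtained by parts, expresses [B (al, z)] through [B (al, z + n)] with exactly
    the factors of Gauss's products, and [n ^ al B (al, z + n)] tends to
    [Gamma al].

    Thirdly, [e_n] is absolutely summable
    ([bessel_maitland_abs_summable]).  Comparing the factors of Gauss's products
    at [z] and [z + s] gives a bound of [rGamma (z + s)] by a multiple of
    [(Re z) ^ (- Re s) * rGamma z] ([rGamma_shift_bound]), without any
    asymptotic expansion of [Gamma].  It bounds the ratio of consecutive terms
    by a multiple of [n ^ (q - Re delta - 1)], which tends to 0.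
    Since [0 < t < 1], the partial sums then converge uniformly, and the series
    may be integrated term by term against an absolutely integrable kernel
    ([cint01_series]). *)

(** * Complex numbers *)

Lemma Cmod_le_abs (z : C) : (Cmod z <= Rabs (Re z) + Rabs (Im z))%R.
Proof.
  destruct z as [x y]; simpl.
  replace (x, y) with (RtoC x + Ci * RtoC y)
    by (unfold Ci; apply injective_projections; simpl; ring).
  eapply Rle_trans; [apply Cmod_triangle|].
  rewrite Cmod_mult, Cmod_Ci, !Cmod_R; lra.
Qed.

Lemma Re_le_Cmod (z : C) : (Rabs (Re z) <= Cmod z)%R.
Proof. eapply Rle_trans; [apply Rmax_l | apply Rmax_Cmod]. Qed.

Lemma Cmod_ge_Re (z : C) : (Re z <= Cmod z)%R.
Proof. eapply Rle_trans; [apply Rle_abs | apply Re_le_Cmod]. Qed.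

Lemma Im_le_Cmod (z : C) : (Rabs (Im z) <= Cmod z)%R.
Proof. eapply Rle_trans; [apply Rmax_r | apply Rmax_Cmod]. Qed.

Lemma Cmod_sqr (z : C) : (Cmod z * Cmod z = Re z * Re z + Im z * Im z)%R.
Proof.
  unfold Cmod; rewrite sqrt_sqrt; [unfold Re, Im; ring|].
  apply Rplus_le_le_0_compat; apply pow2_ge_0.
Qed.

Lemma Cmod_minus_sym (z w : C) : Cmod (z - w) = Cmod (w - z).
Proof. rewrite <- Cmod_opp; f_equal; ring. Qed.

Lemma RtoC_neq0 (x : R) : x <> 0%R -> RtoC x <> 0.
Proof. intros H E; apply H, RtoC_inj, E. Qed.

Lemma neq0_of_Re_pos (z : C) : (0 < Re z)%R -> z <> 0.
Proof. intros H E; rewrite E in H; simpl in H; lra. Qed.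

Lemma Cinv_neq0 (z : C) : z <> 0 -> / z <> 0.
Proof. intros H E; apply C1_nz; rewrite <- (Cinv_r z H), E; ring. Qed.

Lemma Cminus_0_r (z : C) : z - 0 = z.
Proof. ring. Qed.

Lemma Cpow_RtoC (x : R) (n : nat) : RtoC x ^ n = RtoC (x ^ n)%R.
Proof.
  induction n as [|n IH]; [reflexivity|].
  rewrite Cpow_S, IH, <- RtoC_mult; reflexivity.
Qed.

(** * Limits of complex sequences *)

(** Convergence by components, because the limit [clim_seq] of the definitions of
    [rGamma] and [cseries] is taken by components. *)
Definition ccvg (u : nat -> C) (l : C) : Prop :=
  is_lim_seq (fun n => Re (u n)) (Re l) /\ is_lim_seq (fun n => Im (u n)) (Im l).

(** Identifies [rGamma] and [cseries], which are defined by the total operator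
    [clim_seq], once convergence is known. *)
Lemma ccvg_clim (u : nat -> C) (l : C) : ccvg u l -> clim_seq u = l.
Proof.
  intros [H1 H2]; unfold clim_seq.
  rewrite (is_lim_seq_unique _ _ H1), (is_lim_seq_unique _ _ H2).
  destruct l; reflexivity.
Qed.

Lemma ccvg_unique (u : nat -> C) (l l' : C) : ccvg u l -> ccvg u l' -> l = l'.
Proof. intros H H'; rewrite <- (ccvg_clim _ _ H); now apply ccvg_clim. Qed.

Lemma ccvg_const (c : C) : ccvg (fun _ => c) c.
Proof. split; apply is_lim_seq_const. Qed.

Lemma ccvg_ext_from (N : nat) (u v : nat -> C) (l : C) :
  (forall n, (N <= n)%nat -> u n = v n) -> ccvg u l -> ccvg v l.
Proof.
  intros E [H1 H2]; split; eapply is_lim_seq_ext_loc; try eassumption;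
    exists N; intros n Hn; now rewrite E.
Qed.

Lemma ccvg_plus (u v : nat -> C) (l m : C) :
  ccvg u l -> ccvg v m -> ccvg (fun n => u n + v n) (l + m).
Proof. intros [H1 H2] [H3 H4]; split; simpl; now apply is_lim_seq_plus'. Qed.

Lemma ccvg_mult (u v : nat -> C) (l m : C) :
  ccvg u l -> ccvg v m -> ccvg (fun n => u n * v n) (l * m).
Proof.
  intros [H1 H2] [H3 H4]; split; simpl.
  - apply is_lim_seq_minus'; now apply is_lim_seq_mult'.
  - apply is_lim_seq_plus'; now apply is_lim_seq_mult'.
Qed.

Lemma ccvg_incr_1 (u : nat -> C) (l : C) :
  ccvg (fun n => u (S n)) l -> ccvg u l.
Proof.
  intros [H1 H2]; split; apply is_lim_seq_incr_1; assumption.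
Qed.

(** With [ccvg_Cmod_sub], makes squeezing arguments on the modulus available. *)
Lemma ccvg_of_Cmod (u : nat -> C) (l : C) :
  is_lim_seq (fun n => Cmod (u n - l)) 0%R -> ccvg u l.
Proof.
  intros H; split.
  - apply is_lim_seq_ext with (fun n => (Re (u n - l) + Re l)%R).
    { intros n; simpl; unfold Re, Im; ring. }
    replace (Finite (Re l)) with (Finite (0 + Re l)%R) by (f_equal; ring).
    apply is_lim_seq_plus'; [|apply is_lim_seq_const].
    apply is_lim_seq_abs_0.
    apply is_lim_seq_le_le with (fun _ => 0%R) (fun n => Cmod (u n - l));
      [|apply is_lim_seq_const|assumption].
    intros n; split; [apply Rabs_pos | apply Re_le_Cmod].
  - apply is_lim_seq_ext with (fun n => (Im (u n - l) + Im l)%R).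
    { intros n; simpl; unfold Re, Im; ring. }
    replace (Finite (Im l)) with (Finite (0 + Im l)%R) by (f_equal; ring).
    apply is_lim_seq_plus'; [|apply is_lim_seq_const].
    apply is_lim_seq_abs_0.
    apply is_lim_seq_le_le with (fun _ => 0%R) (fun n => Cmod (u n - l));
      [|apply is_lim_seq_const|assumption].
    intros n; split; [apply Rabs_pos | apply Im_le_Cmod].
Qed.

Lemma ccvg_Cmod_sub (u : nat -> C) (l : C) :
  ccvg u l -> is_lim_seq (fun n => Cmod (u n - l)) 0%R.
Proof.
  intros [H1 H2].
  apply is_lim_seq_le_le with (fun _ => 0%R)
    (fun n => (Rabs (Re (u n) - Re l) + Rabs (Im (u n) - Im l))%R).
  - intros n; split; [apply Cmod_ge_0 | apply (Cmod_le_abs (u n - l))].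
  - apply is_lim_seq_const.
  - replace (Finite 0%R) with (Finite (Rabs (Re l - Re l) + Rabs (Im l - Im l))%R).
    2: { f_equal; rewrite !Rminus_diag, Rabs_R0; ring. }
    apply is_lim_seq_plus';
      apply (is_lim_seq_abs _ (Finite _)), is_lim_seq_minus';
      try assumption; apply is_lim_seq_const.
Qed.

Lemma ccvg_Cmod (u : nat -> C) (l : C) :
  ccvg u l -> is_lim_seq (fun n => Cmod (u n)) (Cmod l).
Proof.
  intros H; apply ccvg_Cmod_sub in H.
  apply is_lim_seq_le_le with (fun n => (Cmod l - Cmod (u n - l))%R)
    (fun n => (Cmod l + Cmod (u n - l))%R).
  - intros n; split.
    + rewrite Cmod_minus_sym.
      replace (Cmod l) with (Cmod ((l - u n) + u n)) by (f_equal; ring).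
      pose proof (Cmod_triangle (l - u n) (u n)); lra.
    + replace (Cmod (u n)) with (Cmod (l + (u n - l))) by (f_equal; ring).
      apply Cmod_triangle.
  - replace (Finite (Cmod l)) with (Finite (Cmod l - 0)%R) by (f_equal; ring).
    apply is_lim_seq_minus'; [apply is_lim_seq_const|assumption].
  - replace (Finite (Cmod l)) with (Finite (Cmod l + 0)%R) by (f_equal; ring).
    apply is_lim_seq_plus'; [apply is_lim_seq_const|assumption].
Qed.

(** * Series *)

Lemma Re_sum_n (u : nat -> C) (n : nat) :
  Re (sum_n (G := C_AbelianMonoid) u n) = sum_n (fun k => Re (u k)) n.
Proof.
  induction n as [|n IH]; [now rewrite !sum_O|].
  rewrite !sum_Sn, <- IH; reflexivity.
Qed.

Lemma Im_sum_n (u : nat -> C) (n : nat) :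
  Im (sum_n (G := C_AbelianMonoid) u n) = sum_n (fun k => Im (u k)) n.
Proof.
  induction n as [|n IH]; [now rewrite !sum_O|].
  rewrite !sum_Sn, <- IH; reflexivity.
Qed.

Lemma ex_series_Re (u : nat -> C) :
  ex_series (fun n => Cmod (u n)) -> ex_series (fun n => Re (u n)).
Proof.
  apply (ex_series_le (K := R_AbsRing) (V := R_CompleteNormedModule)).
  intros n; apply Re_le_Cmod.
Qed.

Lemma ex_series_Im (u : nat -> C) :
  ex_series (fun n => Cmod (u n)) -> ex_series (fun n => Im (u n)).
Proof.
  apply (ex_series_le (K := R_AbsRing) (V := R_CompleteNormedModule)).
  intros n; apply Im_le_Cmod.
Qed.

Lemma ccvg_series_components (u : nat -> C) :
  ex_series (fun n => Cmod (u n)) ->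
  ccvg (sum_n (G := C_AbelianMonoid) u)
    (Series (fun n => Re (u n)), Series (fun n => Im (u n))).
Proof.
  intros H; split; simpl.
  - apply is_lim_seq_ext with (sum_n (fun k => Re (u k))).
    { intros n; symmetry; apply Re_sum_n. }
    apply Series_correct, ex_series_Re, H.
  - apply is_lim_seq_ext with (sum_n (fun k => Im (u k))).
    { intros n; symmetry; apply Im_sum_n. }
    apply Series_correct, ex_series_Im, H.
Qed.

Lemma cseries_components (u : nat -> C) :
  ex_series (fun n => Cmod (u n)) ->
  cseries u = (Series (fun n => Re (u n)), Series (fun n => Im (u n))).
Proof. intros H; now apply ccvg_clim, ccvg_series_components. Qed.

Lemma ccvg_series (u : nat -> C) :
  ex_series (fun n => Cmod (u n)) -> ccvg (sum_n (G := C_AbelianMonoid) u) (cseries u).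
Proof.
  intros H; rewrite (cseries_components u H); now apply ccvg_series_components.
Qed.

Lemma ex_series_C (u : nat -> C) :
  ex_series (fun n => Cmod (u n)) -> ex_series (V := C_NormedModule) u.
Proof.
  intros H.
  apply (ex_series_le (K := C_AbsRing) (V := C_CompleteNormedModule)) with (2 := H).
  intros n; apply Rle_refl.
Qed.

Lemma cseries_scal (c : C) (u : nat -> C) :
  ex_series (fun n => Cmod (u n)) -> cseries (fun n => c * u n) = c * cseries u.
Proof.
  intros Hu; apply ccvg_clim.
  apply ccvg_ext_from with (N := O) (u := fun n => c * sum_n (G := C_AbelianMonoid) u n).
  - intros n _; induction n as [|n IH]; [now rewrite !sum_O|].
    rewrite !sum_Sn, <- IH; unfold plus; simpl; ring.
  - apply ccvg_mult; [apply ccvg_const | now apply ccvg_series].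
Qed.

Lemma cseries_ext (u v : nat -> C) : (forall n, u n = v n) -> cseries u = cseries v.
Proof.
  intros E; unfold cseries, clim_seq.
  f_equal; f_equal; apply Lim_seq_ext; intros n; f_equal; now apply sum_n_ext.
Qed.

(** * The complex exponential *)

Lemma cexp_plus (z w : C) : cexp (z + w) = cexp z * cexp w.
Proof.
  destruct z as [a b], w as [c d]; unfold cexp; simpl.
  rewrite exp_plus, cos_plus, sin_plus.
  apply injective_projections; simpl; ring.
Qed.

Lemma cexp_0 : cexp 0 = 1.
Proof.
  unfold cexp; simpl; rewrite exp_0, cos_0, sin_0.
  apply injective_projections; simpl; ring.
Qed.

Lemma Cmod_cexp (z : C) : Cmod (cexp z) = exp (Re z).
Proof.
  unfold cexp; rewrite Cmod_mult, Cmod_R, Rabs_pos_eq by (left; apply exp_pos).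
  unfold Cmod; simpl.
  replace (cos (Im z) * (cos (Im z) * 1) + sin (Im z) * (sin (Im z) * 1))%R
    with (Rsqr (sin (Im z)) + Rsqr (cos (Im z)))%R by (unfold Rsqr; ring).
  rewrite sin2_cos2, sqrt_1; ring.
Qed.

Lemma cexp_neq0 (z : C) : cexp z <> 0.
Proof. apply Cmod_gt_0; rewrite Cmod_cexp; apply exp_pos. Qed.

Lemma cexp_opp (z : C) : cexp (- z) = / cexp z.
Proof.
  assert (cexp z * cexp (- z) = 1) as H.
  { rewrite <- cexp_plus, <- cexp_0; f_equal; ring. }
  rewrite <- (Cmult_1_l (/ cexp z)), <- H.
  field; apply cexp_neq0.
Qed.

Lemma cexp_RtoC (x : R) : cexp (RtoC x) = RtoC (exp x).
Proof.
  unfold cexp; simpl; rewrite cos_0, sin_0.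
  apply injective_projections; simpl; ring.
Qed.

Lemma exp_ge_1_plus (x : R) : (1 + x <= exp x)%R.
Proof. 
  destruct (Req_dec x 0) as [->|H]; [rewrite exp_0; lra|].
  left; now apply exp_ineq1.
Qed.

Lemma exp_le_mono (x y : R) : (x <= y)%R -> (exp x <= exp y)%R.
Proof.
  intros [H| ->]; [left; now apply exp_increasing | apply Rle_refl].
Qed.

Lemma exp_minus_1_bounds (x : R) : (x <= exp x - 1 <= x * exp x)%R.
Proof.
  split; [pose proof (exp_ge_1_plus x); lra|].
  pose proof (exp_ge_1_plus (- x)) as H; rewrite exp_Ropp in H.
  pose proof (exp_pos x) as P.
  apply (Rmult_le_compat_l (exp x)) in H; [|lra].
  rewrite Rinv_r in H by lra; lra.
Qed.

Lemma abs_exp_minus_1 (x : R) : (Rabs (exp x - 1) <= Rabs x * exp (Rabs x))%R.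
Proof.
  destruct (exp_minus_1_bounds x) as [H1 H2].
  destruct (Rle_lt_dec 0 x) as [H|H].
  - rewrite (Rabs_pos_eq x) by lra; rewrite Rabs_pos_eq; lra.
  - rewrite (Rabs_left x) by lra.
    assert (1 <= exp (- x))%R by (pose proof (exp_ge_1_plus (-x)); lra).
    assert (exp x < 1)%R by (rewrite <- exp_0; now apply exp_increasing).
    rewrite Rabs_left by lra; nra.
Qed.

(** From [1 + x <= exp x] at [x] and at [- x], one gets
    [0 <= exp x - 1 - x <= x (exp x - 1)]. *)
Lemma abs_exp_minus_1_minus_id (x : R) :
  (Rabs (exp x - 1 - x) <= x * x * exp (Rabs x))%R.
Proof.
  destruct (exp_minus_1_bounds x) as [H1 H2].
  rewrite Rabs_pos_eq by lra.
  pose proof (abs_exp_minus_1 x).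
  assert (exp x - 1 - x <= Rabs x * Rabs (exp x - 1))%R.
  { rewrite <- Rabs_mult; eapply Rle_trans; [|apply Rle_abs]; lra. }
  assert (x * x = Rabs x * Rabs x)%R as ->
    by (rewrite <- Rabs_mult, Rabs_pos_eq; nra).
  pose proof (Rabs_pos x); nra.
Qed.

Lemma abs_sin_le (y : R) : (Rabs (sin y) <= Rabs y)%R.
Proof.
  destruct (Rle_lt_dec 0 y) as [H|H].
  - rewrite (Rabs_pos_eq y) by lra.
    destruct (Req_dec y 0) as [->|H0]; [rewrite sin_0, Rabs_R0; lra|].
    apply Rabs_le; split; [|left; apply sin_lt_x; lra].
    destruct (Rle_lt_dec y PI); [pose proof (sin_ge_0 y); lra|].
    pose proof (SIN_bound y); pose proof PI2_1; lra.
  - rewrite (Rabs_left y) by lra.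
    replace (sin y) with (- sin (- y))%R by (rewrite sin_neg; ring).
    rewrite Rabs_Ropp.
    apply Rabs_le; split; [|left; apply sin_lt_x; lra].
    destruct (Rle_lt_dec (-y) PI); [pose proof (sin_ge_0 (-y)); lra|].
    pose proof (SIN_bound (-y)); pose proof PI2_1; lra.
Qed.

(** Both bounds come from [1 - cos y = 2 sin (y / 2) ^ 2]; the quadratic one serves
    for small [y], the linear one is what the mean value argument for the sine needs. *)
Lemma abs_cos_minus_1 (y : R) :
  (Rabs (cos y - 1) <= y * y)%R /\ (Rabs (cos y - 1) <= Rabs y)%R.
Proof.
  replace (cos y - 1)%R with (- (2 * (sin (y / 2) * sin (y / 2))))%R.
  2: { replace y with (2 * (y / 2))%R at 3 by field; rewrite cos_2a_sin; ring. }
  rewrite Rabs_Ropp, !Rabs_mult, (Rabs_pos_eq 2) by lra.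
  pose proof (abs_sin_le (y / 2)) as H.
  assert (Rabs (y / 2) = Rabs y / 2)%R as E
    by (unfold Rdiv; rewrite Rabs_mult, (Rabs_pos_eq (/ 2)) by lra; reflexivity).
  rewrite E in H.
  assert (Rabs (sin (y / 2)) <= 1)%R by (apply Rabs_le, SIN_bound).
  assert (y * y = Rabs y * Rabs y)%R as ->
    by (rewrite <- Rabs_mult, Rabs_pos_eq; nra).
  pose proof (Rabs_pos (sin (y / 2))); pose proof (Rabs_pos y); nra.
Qed.

Lemma abs_sin_minus_id (y : R) : (Rabs (sin y - y) <= y * y)%R.
Proof.
  destruct (MVT_gen (fun t => sin t - t)%R 0 y (fun t => cos t - 1)%R)
    as [c [Hc Heq]].
  - intros; auto_derive; [trivial|ring].
  - intros x Hx; apply derivable_continuous_pt; reg.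
  - rewrite sin_0 in Heq; replace (sin y - y)%R with ((cos c - 1) * (y - 0))%R by lra.
    rewrite Rabs_mult, Rminus_0_r.
    destruct (abs_cos_minus_1 c) as [_ H].
    assert (Rabs c <= Rabs y)%R.
    { revert Hc; unfold Rmin, Rmax; destruct (Rle_dec 0 y); intros;
        unfold Rabs; destruct (Rcase_abs c), (Rcase_abs y); lra. }
    assert (y * y = Rabs y * Rabs y)%R as ->
      by (rewrite <- Rabs_mult, Rabs_pos_eq; nra).
    pose proof (Rabs_pos y); nra.
Qed.

(** Taylor estimate behind Gauss's limit: it makes the factors of the product
    [1 + O (1 / n ^ 2)]. *)
Lemma cexp_second_order (u : C) :
  (Cmod (cexp u - 1 - u) <= 3 * (Cmod u * Cmod u) * exp (Cmod u))%R.
Proof.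
  eapply Rle_trans; [apply Cmod_le_abs|].
  rewrite Cmod_sqr.
  assert (exp (Rabs (Re u)) <= exp (Cmod u))%R as HE.
  { destruct (Re_le_Cmod u) as [H|H]; [left; now apply exp_increasing|rewrite H; lra]. }
  destruct u as [x y]; unfold cexp; simpl Re in *; simpl Im.
  set (E := exp (Cmod (x, y))) in *; clearbody E.
  replace ((exp x * cos y - 0 * sin y + - (1) + - x))%R
    with ((exp x - 1 - x) + exp x * (cos y - 1))%R by ring.
  replace ((exp x * sin y + 0 * cos y + - 0 + - y))%R
    with (exp x * (sin y - y) + (exp x - 1) * y)%R by ring.
  pose proof (abs_exp_minus_1 x) as H1.
  pose proof (abs_exp_minus_1_minus_id x) as H2.
  destruct (abs_cos_minus_1 y) as [H3 _].
  pose proof (abs_sin_minus_id y) as H4.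
  assert (exp x <= exp (Rabs x))%R as H5.
  { destruct (Rle_abs x) as [H|H]; [left; now apply exp_increasing|rewrite <- H; lra]. }
  set (e := exp (Rabs x)) in *.
  pose proof (exp_pos x).
  pose proof (Rabs_triang (exp x - 1 - x) (exp x * (cos y - 1))) as T1.
  pose proof (Rabs_triang (exp x * (sin y - y)) ((exp x - 1) * y)) as T2.
  rewrite !Rabs_mult, (Rabs_pos_eq (exp x)) in T1, T2 by lra.
  assert (exp x * Rabs (cos y - 1) <= e * (y * y))%R
    by (apply Rmult_le_compat; try lra; apply Rabs_pos).
  assert (exp x * Rabs (sin y - y) <= e * (y * y))%R
    by (apply Rmult_le_compat; try lra; apply Rabs_pos).
  assert (Rabs (exp x - 1) * Rabs y <= Rabs x * e * Rabs y)%R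
    by (apply Rmult_le_compat_r; [apply Rabs_pos | assumption]).
  assert (x * x = Rabs x * Rabs x)%R as Ex
    by (rewrite <- Rabs_mult, Rabs_pos_eq; nra).
  assert (y * y = Rabs y * Rabs y)%R as Ey
    by (rewrite <- Rabs_mult, Rabs_pos_eq; nra).
  assert (0 < e)%R by apply exp_pos.
  apply Rle_trans with (3 * (x * x + y * y) * e)%R.
  2: { apply Rmult_le_compat_l; nra. }
  assert (Rabs x * e * Rabs y <= e * (x * x + y * y))%R.
  { rewrite Ex, Ey; pose proof (pow2_ge_0 (Rabs x - Rabs y)); nra. }
  assert (0 <= x * x * e)%R by (apply Rmult_le_pos; nra).
  rewrite (Rabs_mult (exp x - 1) y) in T2; lra.
Qed.

(** In the left half-plane the bound is linear with no exponential factor; it is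
    applied to [z ln t] with [0 < t < 1]. *)
Lemma cexp_first_order (u : C) :
  (Re u <= 0)%R -> (Cmod (cexp u - 1) <= 3 * Cmod u)%R.
Proof.
  intros Hu; eapply Rle_trans; [apply Cmod_le_abs|].
  pose proof (Re_le_Cmod u) as Hr; pose proof (Im_le_Cmod u) as Hi.
  destruct u as [x y]; unfold cexp; simpl Re in *; simpl Im in *.
  replace (exp x * cos y - 0 * sin y + - (1))%R
    with ((exp x - 1) + exp x * (cos y - 1))%R by ring.
  replace (exp x * sin y + 0 * cos y + - 0)%R with (exp x * sin y)%R by ring.
  assert (exp x <= 1)%R.
  { destruct Hu as [Hu| ->]; [|rewrite exp_0; lra].
    left; rewrite <- exp_0; now apply exp_increasing. }
  pose proof (exp_pos x).
  pose proof (exp_minus_1_bounds x).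
  destruct (abs_cos_minus_1 y) as [_ H3].
  pose proof (abs_sin_le y) as H4.
  pose proof (Rabs_triang (exp x - 1) (exp x * (cos y - 1))) as T1.
  rewrite !Rabs_mult, (Rabs_pos_eq (exp x)) in * by lra.
  assert (Rabs (exp x - 1) <= Rabs x)%R by (rewrite (Rabs_left1 x), Rabs_left1; lra).
  pose proof (Rabs_pos (cos y - 1)); pose proof (Rabs_pos (sin y)).
  assert (exp x * Rabs (cos y - 1) <= Rabs y)%R by nra.
  assert (exp x * Rabs (sin y) <= Rabs y)%R by nra.
  lra.
Qed.

(** * Powers *)

Lemma cpower_plus (x : R) (s t : C) : cpower x (s + t) = cpower x s * cpower x t.
Proof. unfold cpower; rewrite <- cexp_plus; f_equal; ring. Qed.

Lemma cpower_neq0 (x : R) (s : C) : cpower x s <> 0.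
Proof. apply cexp_neq0. Qed.

Lemma Cmod_cpower (x : R) (s : C) : Cmod (cpower x s) = exp (Re s * ln x).
Proof. unfold cpower; rewrite Cmod_cexp; f_equal; simpl; unfold Re; ring. Qed.

Lemma cpower_1_r (x : R) : (0 < x)%R -> cpower x 1 = x.
Proof.
  intros Hx; unfold cpower; rewrite Cmult_1_l, cexp_RtoC, exp_ln; auto.
Qed.

Lemma cpower_pred (x : R) (s : C) : (0 < x)%R -> cpower x s = x * cpower x (s - 1).
Proof.
  intros Hx; rewrite <- (cpower_1_r x Hx), <- cpower_plus; f_equal; ring.
Qed.

Lemma cpower_nat (t : R) (n : nat) : (0 < t)%R -> cpower t (INR n) = RtoC t ^ n.
Proof.
  intros Ht; induction n as [|n IH].
  - unfold cpower; simpl; rewrite Cmult_0_l; apply cexp_0.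
  - rewrite S_INR, RtoC_plus, cpower_plus, cpower_1_r, IH, Cpow_S by assumption; ring.
Qed.

(** * Gauss's limit for the reciprocal Gamma function *)

(** All convergence estimates below reduce to sums of inverse squares; this bound
    lets them telescope, so that no value of such a sum is needed. *)
Lemma inv_square_le_telescope (w u : R) :
  (0 < w <= u -> / (u * u) <= (w + 1) / w * (/ u - / (u + 1)))%R.
Proof.
  intros [Hw Hu].
  replace ((w + 1) / w * (/ u - / (u + 1)))%R
    with (/ (u * u) * (((w + 1) * u) / (w * (u + 1))))%R by (field; lra).
  rewrite <- (Rmult_1_r (/ (u * u))) at 1.
  apply Rmult_le_compat_l; [left; apply Rinv_0_lt_compat; nra|].
  apply Rmult_le_reg_r with (w * (u + 1))%R; [nra|].
  unfold Rdiv; rewrite Rmult_assoc, Rinv_l; nra.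
Qed.

Lemma inv_square_nat_le_telescope (n : nat) :
  (/ (INR (S n) * INR (S n)) <= 2 * (/ INR (S n) - / INR (S (S n))))%R.
Proof.
  pose proof (pos_INR n).
  pose proof (inv_square_le_telescope 1 (INR (S n))) as Ht.
  rewrite S_INR in *; rewrite (S_INR (S n)), S_INR.
  replace ((1 + 1) / 1)%R with 2%R in Ht by field.
  apply Ht; lra.
Qed.

Lemma is_series_telescope (b : nat -> R) (l : R) :
  is_lim_seq b l -> is_series (fun n => b n - b (S n))%R (b O - l)%R.
Proof.
  intros H.
  change (is_lim_seq (sum_n (fun n => b n - b (S n))%R) (b O - l)%R).
  apply is_lim_seq_ext with (fun n => b O - b (S n))%R.
  - induction n as [|n IH]; [now rewrite sum_O|].
    rewrite sum_Sn, <- IH; unfold plus; simpl; ring.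
  - apply is_lim_seq_minus'; [apply is_lim_seq_const|].
    now apply is_lim_seq_incr_1 in H.
Qed.

Lemma is_lim_seq_inv_S : is_lim_seq (fun n => / INR (S n))%R 0%R.
Proof.
  apply (is_lim_seq_incr_1 (fun n => / INR n)%R).
  replace (Finite 0%R) with (Rbar_inv p_infty) by reflexivity.
  apply is_lim_seq_inv; [apply is_lim_seq_INR|discriminate].
Qed.

(** Convergence of an infinite product with factors [1 + O (1 / n ^ 2)], stated for
    its partial products.  They stay bounded by [u 0] times the exponential of a
    telescoping sum; hence their increments are summable. *)
Lemma ccvg_infinite_product (u : nat -> C) (K : R) :
  (0 <= K)%R ->
  (forall n, Cmod (u (S n) - u n) <= Cmod (u n) * (K * / (INR (S n) * INR (S n))))%R ->
  exists l, ccvg u l.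
Proof.
  intros HK Hu.
  assert (forall n, Cmod (u (S n) - u n)
            <= Cmod (u n) * (2 * K * (/ INR (S n) - / INR (S (S n)))))%R as Hu'.
  { intros n; eapply Rle_trans; [apply Hu|].
    apply Rmult_le_compat_l; [apply Cmod_ge_0|].
    pose proof (inv_square_nat_le_telescope n); nra. }
  assert (forall n, Cmod (u n) <= Cmod (u O) * exp (2 * K * (1 - / INR (S n))))%R as Hb.
  { induction n as [|n IH].
    - simpl INR; replace (2 * K * (1 - / 1))%R with 0%R by field.
      rewrite exp_0; lra.
    - apply Rle_trans with (Cmod (u n) * exp (2 * K * (/ INR (S n) - / INR (S (S n)))))%R.
      + replace (u (S n)) with (u n + (u (S n) - u n)) by ring.
        eapply Rle_trans; [apply Cmod_triangle|].
        pose proof (Hu' n); pose proof (Cmod_ge_0 (u n)).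
        pose proof (exp_ge_1_plus (2 * K * (/ INR (S n) - / INR (S (S n))))).
        nra.
      + replace (2 * K * (1 - / INR (S (S n))))%R
          with (2 * K * (1 - / INR (S n)) + 2 * K * (/ INR (S n) - / INR (S (S n))))%R
          by ring.
        rewrite exp_plus, <- Rmult_assoc.
        apply Rmult_le_compat_r; [left; apply exp_pos | exact IH]. }
  set (M := (Cmod (u O) * exp (2 * K))%R).
  assert (forall n, Cmod (u n) <= M)%R as HM.
  { intros n; eapply Rle_trans; [apply Hb|].
    apply Rmult_le_compat_l; [apply Cmod_ge_0|].
    assert (0 < / INR (S n))%R by (apply Rinv_0_lt_compat, lt_0_INR; lia).
    apply exp_le_mono; nra. }
  assert (ex_series (fun n => Cmod (u (S n) - u n))) as Hs.
  { apply (ex_series_le (K := R_AbsRing) (V := R_CompleteNormedModule))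
      with (b := fun n => (2 * K * M * (/ INR (S n) - / INR (S (S n))))%R).
    - intros n.
      change (Rabs (Cmod (u (S n) - u n))
              <= 2 * K * M * (/ INR (S n) - / INR (S (S n))))%R.
      rewrite Rabs_pos_eq by apply Cmod_ge_0.
      eapply Rle_trans; [apply Hu'|].
      pose proof (HM n).
      assert (0 <= / INR (S n) - / INR (S (S n)))%R.
      { pose proof (inv_square_nat_le_telescope n).
        assert (0 < / (INR (S n) * INR (S n)))%R; [|lra].
        apply Rinv_0_lt_compat, Rmult_lt_0_compat; apply lt_0_INR; lia. }
      assert (0 <= 2 * K * (/ INR (S n) - / INR (S (S n))))%R
        by (apply Rmult_le_pos; lra).
      replace (2 * K * M * (/ INR (S n) - / INR (S (S n))))%R
        with (M * (2 * K * (/ INR (S n) - / INR (S (S n)))))%R by ring.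
      now apply Rmult_le_compat_r.
    - apply (ex_series_scal_l (V := R_NormedModule)).
      eexists; apply (is_series_telescope (fun n => / INR (S n))%R), is_lim_seq_inv_S. }
  exists (u O + cseries (fun n => u (S n) - u n)).
  apply ccvg_incr_1.
  apply ccvg_ext_from with (N := O)
    (u := fun n => u O + sum_n (G := C_AbelianMonoid) (fun n => u (S n) - u n) n).
  - intros n _; induction n as [|n IH].
    + rewrite sum_O; ring.
    + rewrite sum_Sn; unfold plus; simpl.
      transitivity (u (S n) + (u (S (S n)) - u (S n))); [|ring].
      rewrite <- IH at 1; ring.
  - apply ccvg_plus; [apply ccvg_const|]. apply ccvg_series, Hs.
Qed.

Definition gauss (z : C) (n : nat) : C :=
  rising z (S n) / (INR (fact n) * cpower (INR n) z).

Lemma fact_neq0 (n : nat) : RtoC (INR (fact n)) <> 0.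
Proof. apply RtoC_neq0, INR_fact_neq_0. Qed.

Lemma ln_succ_bounds (u : R) :
  (0 < u -> / (u + 1) <= ln (u + 1) - ln u <= / u)%R.
Proof.
  intros Hu.
  assert (forall t, -1 < t -> ln (1 + t) <= t)%R as L.
  { intros t Ht; rewrite <- (ln_exp t) at 2.
    apply ln_le; [lra | apply exp_ge_1_plus]. }
  split.
  - replace (ln u) with (ln (u + 1) + ln (1 + - / (u + 1)))%R.
    + pose proof (L (- / (u + 1)))%R as H.
      assert (/ (u + 1) < 1)%R by (rewrite <- Rinv_1; apply Rinv_lt_contravar; lra).
      lra.
    + assert (1 + - / (u + 1) = u / (u + 1))%R as -> by (field; lra).
      rewrite <- ln_mult; [f_equal; field; lra|lra|].
      apply Rdiv_lt_0_compat; lra.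
  - replace (ln (u + 1)) with (ln u + ln (1 + / u))%R.
    + assert (0 < / u)%R by now apply Rinv_0_lt_compat.
      pose proof (L (/ u))%R; lra.
    + assert (0 < / u)%R by now apply Rinv_0_lt_compat.
      rewrite <- ln_mult; [f_equal; field; lra|lra|lra].
Qed.

Lemma INR_S_pos (n : nat) : (0 < INR (S n))%R.
Proof. apply lt_0_INR; lia. Qed.

Lemma gauss_step (z : C) (n : nat) :
  let l := (ln (INR (S (S n))) - ln (INR (S n)))%R in
  gauss z (S (S n))
  = gauss z (S n) * ((1 + z / INR (S (S n))) * cexp (- (z * l))).
Proof.
  intros l; unfold gauss, cpower.
  replace (z * ln (INR (S (S n)))) with (z * ln (INR (S n)) + z * l)
    by (unfold l; rewrite RtoC_minus; ring).
  rewrite cexp_plus, cexp_opp.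
  change (rising z (S (S (S n)))) with (rising z (S (S n)) * (z + INR (S (S n)))).
  rewrite (fact_simpl (S n)), mult_INR, RtoC_mult.
  pose proof (cexp_neq0 (z * l)); pose proof (cexp_neq0 (z * ln (INR (S n)))).
  pose proof (fact_neq0 (S n)).
  assert (RtoC (INR (S (S n))) <> 0) by (apply RtoC_neq0, Rgt_not_eq, INR_S_pos).
  field; repeat split; assumption.
Qed.

(** The first bound concerns the factor of [gauss_step].  The second one leads to the
    inverse factor, [exp (z l) / (1 + z / k)].  In both, the terms of first order
    cancel because [l], the increment of the logarithm, is [1 / k] up to [O (1 / n ^ 2)]. *)
Lemma Cmod_gauss_step (z : C) (n : nat) :
  let l := (ln (INR (S (S n))) - ln (INR (S n)))%R in
  let K := (Cmod z + 4 * (1 + Cmod z) * (Cmod z * Cmod z) * exp (Cmod z))%R in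
  (Cmod ((1 + z / INR (S (S n))) * cexp (- (z * l)) - 1)
     <= K * / (INR (S n) * INR (S n)) /\
   Cmod (cexp (z * l) - 1 - z / INR (S (S n))) <= K * / (INR (S n) * INR (S n)))%R.
Proof.
  intros l K.
  pose proof (INR_S_pos n) as Hp.
  destruct (ln_succ_bounds (INR (S n)) Hp) as [L1 L2].
  rewrite <- (S_INR (S n)) in L1, L2; fold l in L1, L2.
  set (k := INR (S (S n))) in *; assert (k = INR (S n) + 1)%R as Ek by apply S_INR.
  assert (1 <= INR (S n))%R as H1 by (rewrite S_INR; pose proof (pos_INR n); lra).
  set (m := INR (S n)) in *; clearbody l k m.
  assert (0 < / m)%R as Hm by now apply Rinv_0_lt_compat.
  assert (/ m <= 1)%R as Hm1 by (rewrite <- Rinv_1; apply Rinv_le_contravar; lra).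
  assert (0 < / k)%R as Hk by (apply Rinv_0_lt_compat; lra).
  assert (/ m - / k <= / m * / m)%R as Hmk.
  { subst k. replace (/ m - / (m + 1))%R with (/ m * / (m + 1))%R by (field; lra).
    apply Rmult_le_compat_l; [lra|]. apply Rinv_le_contravar; lra. }
  rewrite Rinv_mult.
  assert (forall s, Cmod s = Cmod z ->
    Cmod (cexp (s * l) - 1 - s * l) <= 3 * (Cmod z * Cmod z) * exp (Cmod z) * (/ m * / m))%R
    as Hexp.
  { intros s Hs; eapply Rle_trans; [apply cexp_second_order|].
    rewrite Cmod_mult, Cmod_R, Hs, (Rabs_pos_eq l) by lra.
    assert (exp (Cmod z * l) <= exp (Cmod z))%R
      by (apply exp_le_mono; pose proof (Cmod_ge_0 z); nra).
    assert (l * l <= / m * / m)%R by nra.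
    replace (3 * (Cmod z * l * (Cmod z * l)) * exp (Cmod z * l))%R
      with (3 * (Cmod z * Cmod z) * ((l * l) * exp (Cmod z * l)))%R by ring.
    replace (3 * (Cmod z * Cmod z) * exp (Cmod z) * (/ m * / m))%R
      with (3 * (Cmod z * Cmod z) * ((/ m * / m) * exp (Cmod z)))%R by ring.
    apply Rmult_le_compat_l; [pose proof (Cmod_ge_0 z); nra|].
    apply Rmult_le_compat; try nra; left; apply exp_pos. }
  set (r := Cmod z) in *.
  assert (0 <= r)%R as Hr by apply Cmod_ge_0.
  set (E := exp r) in *; assert (1 <= E)%R as HE.
  { unfold E; rewrite <- exp_0; now apply exp_le_mono. }
  assert (Cmod (z * (l - / k)) <= r * (/ m * / m))%R as Hd.
  { rewrite Cmod_mult, <- RtoC_inv, <- RtoC_minus, Cmod_R by lra; fold r.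
    apply Rmult_le_compat_l; [assumption|]; rewrite Rabs_pos_eq; lra. }
  assert (RtoC k <> 0) as Hk0 by (apply RtoC_neq0; lra).
  split.
  - replace ((1 + z / k) * cexp (- (z * l)) - 1)
      with (- (z * (l - / k)) + (- (z * z * (l / k))
            + (1 + z / k) * (cexp ((- z) * l) - 1 - (- z) * l))).
    2: { replace (- z * l) with (- (z * l)) by ring; field; assumption. }
    eapply Rle_trans; [apply Cmod_triangle|].
    rewrite Cmod_opp.
    assert (Cmod (- (z * z * (l / k))) <= r * r * (/ m * / m))%R.
    { rewrite Cmod_opp, !Cmod_mult, <- RtoC_div, Cmod_R by lra; fold r.
      apply Rmult_le_compat_l; [nra|].
      rewrite Rabs_pos_eq; unfold Rdiv; [|nra].
      apply Rmult_le_compat; lra. }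
    assert (Cmod ((1 + z / k) * (cexp (- z * l) - 1 - - z * l))
              <= (1 + r) * (3 * (r * r) * E * (/ m * / m)))%R.
    { rewrite Cmod_mult; apply Rmult_le_compat; try apply Cmod_ge_0.
      - eapply Rle_trans; [apply Cmod_triangle|].
        rewrite Cmod_1, Cmod_div, Cmod_R by assumption; fold r.
        rewrite Rabs_pos_eq by lra; unfold Rdiv; nra.
      - apply Hexp; unfold r; apply Cmod_opp. }
    pose proof (Cmod_triangle (- (z * z * (l / k)))
                  ((1 + z / k) * (cexp (- z * l) - 1 - - z * l))).
    assert (0 <= / m * / m)%R by nra.
    unfold K.
    assert (r * r * (/ m * / m) <= (1 + r) * (r * r) * E * (/ m * / m))%R.
    { apply Rmult_le_compat_r; [assumption|].
      assert (0 <= r * r)%R by nra.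
      assert (1 <= (1 + r) * E)%R by nra. nra. }
    lra.
  - replace (cexp (z * l) - 1 - z / k)
      with ((z * (l - / k)) + (cexp (z * l) - 1 - z * l)) by (field; assumption).
    eapply Rle_trans; [apply Cmod_triangle|].
    pose proof (Hexp z eq_refl).
    assert (0 <= r * r * E * (/ m * / m))%R
      by (repeat apply Rmult_le_pos; lra).
    assert (0 <= r * (r * r * E * (/ m * / m)))%R by (apply Rmult_le_pos; lra).
    unfold K; lra.
Qed.

Lemma gauss_ex_cvg (z : C) : exists l, ccvg (gauss z) l.
Proof.
  destruct (ccvg_infinite_product (fun n => gauss z (S n))
    (Cmod z + 4 * (1 + Cmod z) * (Cmod z * Cmod z) * exp (Cmod z))) as [l Hl].
  - pose proof (Cmod_ge_0 z); pose proof (exp_pos (Cmod z)).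
    apply Rplus_le_le_0_compat; [lra|]; repeat apply Rmult_le_pos; lra.
  - intros n; rewrite gauss_step.
    set (q := (1 + _) * _).
    replace (gauss z (S n) * q - gauss z (S n)) with (gauss z (S n) * (q - 1)) by ring.
    rewrite Cmod_mult; apply Rmult_le_compat_l; [apply Cmod_ge_0|].
    apply Cmod_gauss_step.
  - exists l; now apply ccvg_incr_1.
Qed.

Lemma gauss_cvg (z : C) : ccvg (gauss z) (rGamma z).
Proof.
  destruct (gauss_ex_cvg z) as [l Hl].
  unfold rGamma; change (ccvg (gauss z) (clim_seq (gauss z))).
  now rewrite (ccvg_clim _ _ Hl).
Qed.

Lemma plus_nat_neq0 (z : C) (n : nat) :
  (0 <= Re z)%R -> z <> 0 -> z + INR n <> 0.
Proof.
  intros Hz Hz0 E.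
  assert (Re z + INR n = 0)%R as ER by (change (Re (z + INR n) = 0%R); now rewrite E).
  pose proof (pos_INR n).
  apply Hz0; replace z with (z + INR n - INR n) by ring.
  rewrite E; replace (INR n) with 0%R by lra; ring.
Qed.

Lemma rising_neq0 (z : C) (n : nat) :
  (0 <= Re z)%R -> z <> 0 -> rising z n <> 0.
Proof.
  intros Hz Hz0; induction n as [|n IH]; simpl; [apply C1_nz|].
  apply Cmult_neq_0; [assumption|now apply plus_nat_neq0].
Qed.

Lemma gauss_neq0 (z : C) (n : nat) :
  (0 <= Re z)%R -> z <> 0 -> gauss z n <> 0.
Proof.
  intros Hz Hz0; unfold gauss, Cdiv.
  apply Cmult_neq_0; [now apply rising_neq0|].
  intros E.
  assert (INR (fact n) * cpower (INR n) z <> 0) as H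
    by (apply Cmult_neq_0; [apply fact_neq0 | apply cpower_neq0]).
  apply C1_nz; rewrite <- (Cinv_r _ H), E; ring.
Qed.

(** The inverse factors are [1 + O (1 / n ^ 2)] too: [Re z >= 0] keeps the
    denominators [1 + z / k] at modulus at least 1. *)
Lemma inv_gauss_ex_cvg (z : C) :
  (0 <= Re z)%R -> z <> 0 -> exists l, ccvg (fun n => / gauss z n) l.
Proof.
  intros Hz Hz0.
  destruct (ccvg_infinite_product (fun n => / gauss z (S n))
    (Cmod z + 4 * (1 + Cmod z) * (Cmod z * Cmod z) * exp (Cmod z))) as [l Hl].
  - pose proof (Cmod_ge_0 z); pose proof (exp_pos (Cmod z)).
    apply Rplus_le_le_0_compat; [lra|]; repeat apply Rmult_le_pos; lra.
  - intros n; rewrite gauss_step.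
    destruct (Cmod_gauss_step z n) as [_ H]; revert H.
    pose proof (gauss_neq0 z (S n) Hz Hz0) as Hg.
    set (l := (ln (INR (S (S n))) - ln (INR (S n)))%R).
    assert (1 <= Cmod (1 + z / INR (S (S n))))%R as Hq.
    { eapply Rle_trans; [|apply Cmod_ge_Re].
      unfold Cdiv; rewrite <- RtoC_inv by (apply Rgt_not_eq, INR_S_pos).
      assert (0 < / INR (S (S n)))%R by apply Rinv_0_lt_compat, INR_S_pos.
      replace (Re (1 + z * RtoC (/ INR (S (S n)))))
        with (1 + Re z * / INR (S (S n)))%R by (unfold Re; cbn -[INR]; ring).
      nra. }
    set (q := 1 + z / INR (S (S n))) in *.
    assert (q <> 0) as Hq0 by (apply Cmod_gt_0; lra).
    replace (cexp (z * l) - 1 - z / INR (S (S n))) with (cexp (z * l) - q)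
      by (unfold q; ring).
    intros H.
    rewrite cexp_opp.
    pose proof (cexp_neq0 (z * l)) as He.
    replace (/ (gauss z (S n) * (q * / cexp (z * l))) - / gauss z (S n))
      with (/ gauss z (S n) * ((cexp (z * l) - q) / q))
      by (field; repeat split; assumption).
    rewrite Cmod_mult; apply Rmult_le_compat_l; [apply Cmod_ge_0|].
    eapply Rle_trans; [|exact H].
    rewrite Cmod_div by assumption.
    apply Rmult_le_reg_r with (Cmod q); [lra|].
    unfold Rdiv; rewrite Rmult_assoc, Rinv_l by lra.
    pose proof (Cmod_ge_0 (cexp (z * l) - q)); nra.
  - exists l; now apply (ccvg_incr_1 (fun n => / gauss z n)).
Qed.

(** The sequences [gauss z] and [/ gauss z] both converge, and the product of their
    limits is 1. *)
Lemma rGamma_neq0 (z : C) : (0 <= Re z)%R -> z <> 0 -> rGamma z <> 0.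
Proof.
  intros Hz Hz0 E.
  destruct (inv_gauss_ex_cvg z Hz Hz0) as [l Hl].
  pose proof (ccvg_mult _ _ _ _ (gauss_cvg z) Hl) as H.
  apply C1_nz, (ccvg_unique (fun _ => 1)); [apply ccvg_const|].
  rewrite E in H; replace (RtoC 0) with (0 * l) by ring.
  eapply ccvg_ext_from with (N := O); [|exact H].
  intros n _; simpl; apply Cinv_r, gauss_neq0; assumption.
Qed.

Lemma inv_gauss_cvg (z : C) :
  (0 <= Re z)%R -> z <> 0 -> ccvg (fun n => / gauss z n) (Gamma z).
Proof.
  intros Hz Hz0.
  destruct (inv_gauss_ex_cvg z Hz Hz0) as [l Hl].
  replace (Gamma z) with l; [assumption|].
  pose proof (rGamma_neq0 z Hz Hz0) as H0.
  assert (rGamma z * l = 1) as E.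
  { apply (ccvg_unique (fun _ => 1)); [|apply ccvg_const].
    eapply ccvg_ext_from with (N := O);
      [|exact (ccvg_mult _ _ _ _ (gauss_cvg z) Hl)].
    intros n _; simpl; apply Cinv_r, gauss_neq0; assumption. }
  unfold Gamma; rewrite <- (Cmult_1_r (/ rGamma z)), <- E; field; assumption.
Qed.

Lemma rising_shift (z : C) (n : nat) : z * rising (z + 1) n = rising z (S n).
Proof.
  induction n as [|n IH]; [simpl; ring|].
  change (rising (z + 1) (S n)) with (rising (z + 1) n * (z + 1 + INR n)).
  change (rising z (S (S n))) with (rising z (S n) * (z + INR (S n))).
  rewrite <- IH, S_INR, RtoC_plus; ring.
Qed.

(** Shifting the rising factorial by one changes Gauss's product by a factor
    [(z + n + 1) / n], which tends to 1. *)
Lemma rGamma_step (z : C) : rGamma z = z * rGamma (z + 1).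
Proof.
  symmetry; apply (ccvg_unique (fun n => z * gauss (z + 1) n)).
  { apply ccvg_mult; [apply ccvg_const | apply gauss_cvg]. }
  assert (ccvg (fun n => 1 + (z + 1) * RtoC (/ INR n)) (1 + (z + 1) * RtoC 0)) as H1.
  { apply ccvg_plus; [apply ccvg_const|apply ccvg_mult; [apply ccvg_const|]].
    apply ccvg_incr_1; split; simpl Im; [apply is_lim_seq_inv_S|apply is_lim_seq_const]. }
  replace (rGamma z) with (rGamma z * (1 + (z + 1) * RtoC 0)) by ring.
  eapply ccvg_ext_from with (N := 1%nat);
    [|exact (ccvg_mult _ _ _ _ (gauss_cvg z) H1)].
  intros n Hn; simpl.
  assert (0 < INR n)%R as Hp by (apply lt_0_INR; lia).
  unfold gauss; rewrite cpower_plus, cpower_1_r by assumption.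
  assert (RtoC (INR n) <> 0) as Hn0 by (apply RtoC_neq0; lra).
  rewrite RtoC_inv by lra.
  pose proof (fact_neq0 n); pose proof (cpower_neq0 (INR n) z).
  transitivity ((z * rising (z + 1) (S n)) / (INR (fact n) * (cpower (INR n) z * INR n)));
    [|field; repeat split; assumption].
  rewrite rising_shift.
  change (rising z (S (S n))) with (rising z (S n) * (z + INR (S n))).
  rewrite S_INR, RtoC_plus; field; repeat split; assumption.
Qed.

(** * Growth of the Gamma function *)

(** The square of the left-hand side is
    [|Z| ^ 2 + 2 Re (s conj Z) + |s| ^ 2], to which [1 + 2 t <= exp (2 t)] applies. *)
Lemma Cmod_add_le_exp (Z s : C) :
  (0 < Re Z)%R ->
  (Cmod (Z + s) <= Cmod Z *
     exp ((Re s * Re Z + Im s * Im Z + (Cmod s * Cmod s) / 2)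
            / (Re Z * Re Z + Im Z * Im Z)))%R.
Proof.
  intros HZ.
  set (N := (Re Z * Re Z + Im Z * Im Z)%R).
  assert (0 < N)%R as HN by (unfold N; nra).
  set (t := (_ / N)%R).
  apply Rsqr_incr_0_var; [|apply Rmult_le_pos; [apply Cmod_ge_0 | left; apply exp_pos]].
  unfold Rsqr; rewrite Cmod_sqr.
  replace (Cmod Z * exp t * (Cmod Z * exp t))%R with (N * exp (2 * t))%R.
  2: { unfold N; rewrite <- Cmod_sqr.
       replace (2 * t)%R with (t + t)%R by ring; rewrite exp_plus; ring. }
  apply Rle_trans with (N * (1 + 2 * t))%R.
  2: { apply Rmult_le_compat_l; [lra | apply exp_ge_1_plus]. }
  unfold t; rewrite Cmod_sqr.
  destruct Z as [u y], s as [a b]; unfold N; simpl in *.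
  right; field; unfold N in HN; simpl in HN; lra.
Qed.

(** A function of [u] whose decrement between [u] and [u + 1] dominates, up to a
    constant, both [1 / u ^ 2] and [|y| / (u ^ 2 + y ^ 2)].  It is bounded uniformly in
    [y], so that the accumulated errors are bounded on whole half-planes. *)
Definition potential (y u : R) : R := (/ u + Rabs y / (u + Rabs y))%R.

Lemma Rinv_mult_self_pos (u : R) : (0 < u -> 0 < / (u * u))%R.
Proof. intros; apply Rinv_0_lt_compat; nra. Qed.

(** One factor of Gauss's products at [Z = u + i y] and at [Z + s].  The exponent of
    [Cmod_add_le_exp] has a main part [Re s * u / |Z| ^ 2], which is compared with
    [Re s] times the increment of the logarithm, and errors absorbed by [potential].
    If [Re s >= 0], replacing [u / |Z| ^ 2] by [1 / u] only loses; if [Re s < 0], this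
    replacement costs [y ^ 2 / u ^ 3], whence the bound on [y] in that case. *)
Lemma Cmod_shift_step (w Y : R) (s : C) :
  (0 < w)%R ->
  let K := ((w + 1) / w * (Cmod s * Cmod s / 2 + 2 * Rabs (Im s)
                            + Rabs (Re s) * (1 + Y * Y / w)))%R in
  forall u y : R, (w <= u)%R -> (0 <= Re s \/ Rabs y <= Y)%R ->
  (Cmod ((u, y) + s) <= Cmod (u, y) *
    exp (Re s * (ln (u + 1) - ln u) + K * (potential y u - potential y (u + 1))))%R.
Proof.
  intros Hw K u y Hu HY.
  eapply Rle_trans; [apply Cmod_add_le_exp; simpl; lra|].
  apply Rmult_le_compat_l; [apply Cmod_ge_0|].
  apply exp_le_mono; simpl Re at 2 3 4; simpl Im at 2 3 4.
  set (sg := Re s); set (ta := Im s); set (m2 := (Cmod s * Cmod s / 2)%R).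
  assert (0 <= m2)%R as Hm2 by (unfold m2; pose proof (Cmod_ge_0 s); nra).
  assert (0 < u)%R as Hu0 by lra.
  set (D := (u * u + y * y)%R).
  assert (u * u <= D)%R as HD1 by (unfold D; nra).
  assert (0 < u * u)%R as Huu by nra.
  assert (0 < D)%R as HD by lra.
  set (c := ((w + 1) / w)%R).
  assert (1 <= c)%R as Hc.
  { unfold c; apply Rmult_le_reg_r with w; [lra|].
    unfold Rdiv; rewrite Rmult_assoc, Rinv_l; lra. }
  pose proof (inv_square_le_telescope w u (conj Hw Hu)) as T1; fold c in T1.
  pose proof (Rabs_pos y) as Hy.
  assert (w <= u + Rabs y)%R as Hu' by lra.
  pose proof (inv_square_le_telescope w (u + Rabs y) (conj Hw Hu')) as T2; fold c in T2.
  pose proof (Rinv_mult_self_pos u Hu0) as P1.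
  assert (potential y u - potential y (u + 1)
    = (/ u - / (u + 1)) + Rabs y * (/ (u + Rabs y) - / (u + Rabs y + 1)))%R as EP.
  { unfold potential; field; lra. }
  rewrite EP.
  set (d1 := (/ u - / (u + 1))%R) in *.
  set (d2 := (/ (u + Rabs y) - / (u + Rabs y + 1))%R) in *.
  assert (0 <= d1)%R as Hd1 by nra.
  assert (0 < / ((u + Rabs y) * (u + Rabs y)))%R as P2 by (apply Rinv_mult_self_pos; lra).
  assert (0 <= d2)%R as Hd2 by nra.
  assert (Rabs y * Rabs y = y * y)%R as Ey by (rewrite <- Rabs_mult, Rabs_pos_eq; nra).
  (* The term of order two in [s]. *)
  assert (m2 / D <= c * m2 * d1)%R as B1.
  { apply Rle_trans with (m2 * / (u * u))%R.
    - apply Rmult_le_compat_l; [assumption|]. now apply Rinv_le_contravar.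
    - replace (c * m2 * d1)%R with (m2 * (c * d1))%R by ring.
      now apply Rmult_le_compat_l. }
  (* The part of the first-order term that carries [Im s], by
     [(u + |y|) ^ 2 <= 2 (u ^ 2 + y ^ 2)]. *)
  assert (ta * y / D <= c * (2 * Rabs ta) * (Rabs y * d2))%R as B2.
  { apply Rle_trans with (Rabs ta * Rabs y * (2 * / ((u + Rabs y) * (u + Rabs y))))%R.
    - rewrite <- Rabs_mult.
      apply Rle_trans with (Rabs (ta * y) * / D)%R.
      + apply Rmult_le_compat_r; [left; now apply Rinv_0_lt_compat | apply Rle_abs].
      + apply Rmult_le_compat_l; [apply Rabs_pos|].
        replace (2 * / ((u + Rabs y) * (u + Rabs y)))%R
          with (/ ((u + Rabs y) * (u + Rabs y) / 2))%R by (field; lra).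
        apply Rinv_le_contravar; [nra|].
        unfold D; rewrite <- Ey; pose proof (pow2_ge_0 (u - Rabs y)); nra.
    - replace (c * (2 * Rabs ta) * (Rabs y * d2))%R
        with (Rabs ta * Rabs y * (2 * (c * d2)))%R by ring.
      apply Rmult_le_compat_l; [|lra].
      apply Rmult_le_pos; apply Rabs_pos. }
  destruct (ln_succ_bounds u Hu0) as [L1 L2].
  set (l := (ln (u + 1) - ln u)%R) in *.
  assert (0 <= Y * Y / w)%R as HYw.
  { apply Rmult_le_pos; [nra | left; now apply Rinv_0_lt_compat]. }
  (* The main part, compared with the increment [l] of the logarithm. *)
  assert (sg * u / D <= sg * l + c * (Rabs sg * (1 + Y * Y / w)) * d1)%R as B3.
  { destruct (Rle_lt_dec 0 sg) as [Hs|Hs].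
    - rewrite (Rabs_pos_eq sg) by assumption.
      assert (u / D <= / u)%R.
      { replace (/ u)%R with (u / (u * u))%R by (field; lra).
        apply Rmult_le_compat_l; [lra|]; now apply Rinv_le_contravar. }
      assert (u / D <= l + d1)%R by (unfold d1; lra).
      assert (d1 <= c * (1 + Y * Y / w) * d1)%R.
      { rewrite <- (Rmult_1_l d1) at 1; apply Rmult_le_compat_r; nra. }
      replace (sg * u / D)%R with (sg * (u / D))%R by (unfold Rdiv; ring).
      replace (sg * l + c * (sg * (1 + Y * Y / w)) * d1)%R
        with (sg * (l + c * (1 + Y * Y / w) * d1))%R by ring.
      apply Rmult_le_compat_l; lra.
    - destruct HY as [HY|HY]; [unfold sg in Hs; lra|].
      rewrite (Rabs_left sg) by assumption.
      assert (/ u - Y * Y / w * / (u * u) <= u / D)%R.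
      { replace (u / D)%R with (/ u - (y * y) / (u * D))%R by (unfold D; field; fold D; lra).
        assert (y * y / (u * D) <= Y * Y / w * / (u * u))%R; [|lra].
        replace (Y * Y / w * / (u * u))%R with (Y * Y * / (w * (u * u)))%R by (field; lra).
        unfold Rdiv; apply Rmult_le_compat.
        - nra.
        - left; apply Rinv_0_lt_compat; nra.
        - rewrite <- Ey; nra.
        - apply Rinv_le_contravar; nra. }
      assert (Y * Y / w * / (u * u) <= c * (Y * Y / w) * d1)%R.
      { replace (c * (Y * Y / w) * d1)%R with (Y * Y / w * (c * d1))%R by ring.
        now apply Rmult_le_compat_l. }
      assert (0 <= c * d1)%R by (apply Rmult_le_pos; lra).
      replace (sg * u / D)%R with (- sg * - (u / D))%R by (unfold Rdiv; ring).
      replace (sg * l + c * (- sg * (1 + Y * Y / w)) * d1)%R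
        with (- sg * (- l + c * d1 + c * (Y * Y / w) * d1))%R by ring.
      apply Rmult_le_compat_l; lra. }
  assert (0 <= c * m2 * (Rabs y * d2))%R
    by (apply Rmult_le_pos; apply Rmult_le_pos; lra).
  assert (0 <= c * (2 * Rabs ta) * d1)%R
    by (pose proof (Rabs_pos ta); apply Rmult_le_pos; [apply Rmult_le_pos|]; lra).
  assert (0 <= Rabs sg * (1 + Y * Y / w))%R
    by (pose proof (Rabs_pos sg); apply Rmult_le_pos; lra).
  assert (0 <= c * (Rabs sg * (1 + Y * Y / w)) * (Rabs y * d2))%R
    by (apply Rmult_le_pos; apply Rmult_le_pos; lra).
  replace ((sg * u + ta * y + m2) / D)%R
    with (sg * u / D + ta * y / D + m2 / D)%R by (unfold Rdiv; ring).
  unfold K; fold c sg ta m2.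
  lra.
Qed.

Lemma Cmod_rising_shift (w Y : R) (s z : C) :
  (0 < w)%R -> (w <= Re z)%R -> (0 <= Re s \/ Rabs (Im z) <= Y)%R ->
  let K := ((w + 1) / w * (Cmod s * Cmod s / 2 + 2 * Rabs (Im s)
                            + Rabs (Re s) * (1 + Y * Y / w)))%R in
  forall n,
  (Cmod (rising (z + s) n) <= Cmod (rising z n) *
    exp (Re s * (ln (Re z + INR n) - ln (Re z))
         + K * (potential (Im z) (Re z) - potential (Im z) (Re z + INR n))))%R.
Proof.
  intros Hw Hz HY K n; induction n as [|n IH].
  - simpl; rewrite Rplus_0_r, !Rminus_diag, !Rmult_0_r, Rplus_0_l, exp_0; lra.
  - simpl rising; rewrite !Cmod_mult.
    pose proof (pos_INR n).
    pose proof (Cmod_shift_step w Y s Hw (Re z + INR n) (Im z) ltac:(lra) HY) as Hs.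
    cbv zeta in Hs; fold K in Hs.
    replace ((Re z + INR n)%R, Im z) with (z + INR n) in Hs
      by (destruct z; apply injective_projections; simpl; ring).
    replace (z + s + INR n) with (z + INR n + s) by ring.
    eapply Rle_trans.
    { apply Rmult_le_compat; [apply Cmod_ge_0 | apply Cmod_ge_0 | exact IH | exact Hs]. }
    rewrite S_INR.
    replace (Re z + (INR n + 1))%R with (Re z + INR n + 1)%R by ring.
    match goal with |- (?a * exp ?b * (?c * exp ?d) <= _ * exp ?e)%R =>
      replace e with (b + d)%R by ring; rewrite (exp_plus b d); right; ring end.
Qed.

Lemma potential_bounds (w u y : R) : (0 < w <= u -> 0 <= potential y u <= / w + 1)%R.
Proof.
  intros [Hw Hu]; unfold potential; pose proof (Rabs_pos y) as Hy.
  assert (0 < / u <= / w)%R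
    by (split; [apply Rinv_0_lt_compat; lra | apply Rinv_le_contravar; lra]).
  assert (0 <= Rabs y / (u + Rabs y) <= 1)%R; [|lra].
  split; [apply Rmult_le_pos; [lra | left; apply Rinv_0_lt_compat; lra]|].
  apply Rmult_le_reg_r with (u + Rabs y)%R; [lra|].
  unfold Rdiv; rewrite Rmult_assoc, Rinv_l; lra.
Qed.

Lemma is_lim_seq_ln_ratio (x : R) :
  (0 < x)%R -> is_lim_seq (fun n => ln (x + INR (S (S n))) - ln (INR (S n)))%R 0%R.
Proof.
  intros Hx.
  apply is_lim_seq_ext with (fun n => ln (1 + (x + 1) * / INR (S n)))%R.
  - intros n; pose proof (INR_S_pos n); pose proof (INR_S_pos (S n)).
    rewrite <- ln_div by lra; f_equal; rewrite (S_INR (S n)); field; lra.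
  - rewrite <- ln_1.
    apply (is_lim_seq_continuous ln).
    { apply derivable_continuous_pt; exists (/ 1)%R; apply derivable_pt_lim_ln; lra. }
    replace (Finite 1%R) with (Finite (1 + (x + 1) * 0)%R) by (f_equal; ring).
    apply is_lim_seq_plus'; [apply is_lim_seq_const|].
    apply is_lim_seq_mult'; [apply is_lim_seq_const | apply is_lim_seq_inv_S].
Qed.

(** A uniform substitute for Stirling's formula: the logarithms of
    [Cmod_rising_shift] telescope to [ln (Re z + n) - ln (Re z)], and [n ^ z] in Gauss's
    formula removes [ln n]. *)
Lemma rGamma_shift_bound (w Y : R) (s : C) :
  (0 < w)%R -> exists K : R, (0 < K)%R /\
  forall z, (w <= Re z)%R -> (0 <= Re s \/ Rabs (Im z) <= Y)%R ->
  (Cmod (rGamma (z + s)) <= K * exp (- Re s * ln (Re z)) * Cmod (rGamma z))%R.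
Proof.
  intros Hw.
  set (K := ((w + 1) / w * (Cmod s * Cmod s / 2 + 2 * Rabs (Im s)
                            + Rabs (Re s) * (1 + Y * Y / w)))%R).
  exists (exp (K * (/ w + 1))); split; [apply exp_pos|].
  intros z Hz HY.
  assert (0 <= K)%R as HK.
  { assert (0 < / w)%R by now apply Rinv_0_lt_compat.
    pose proof (Cmod_ge_0 s); pose proof (Rabs_pos (Im s)); pose proof (Rabs_pos (Re s)).
    unfold K, Rdiv; apply Rmult_le_pos; [nra|].
    assert (0 <= Y * Y * / w)%R by (apply Rmult_le_pos; nra).
    assert (0 <= Rabs (Re s) * (1 + Y * Y * / w))%R by (apply Rmult_le_pos; lra).
    nra. }
  assert (0 < Re z)%R as Hz0 by lra.
  assert (forall n, Cmod (gauss (z + s) (S n)) <=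
     Cmod (gauss z (S n)) * (exp (K * (/ w + 1)) * exp (- Re s * ln (Re z))
       * exp (Re s * (ln (Re z + INR (S (S n))) - ln (INR (S n))))))%R as Hn.
  { intros n; unfold gauss.
    assert (forall t, INR (fact (S n)) * cpower (INR (S n)) t <> 0) as H0
      by (intros t; apply Cmult_neq_0; [apply fact_neq0 | apply cpower_neq0]).
    rewrite !Cmod_div by apply H0.
    rewrite !Cmod_mult, !Cmod_cpower.
    pose proof (Cmod_rising_shift w Y s z Hw Hz HY (S (S n))) as Hr.
    cbv zeta in Hr; fold K in Hr.
    set (F := Cmod (INR (fact (S n)))).
    assert (0 < F)%R as HF by (apply Cmod_gt_0, fact_neq0).
    set (L := ln (INR (S n))).
    apply Rmult_le_reg_r with (F * exp (Re (z + s) * L))%R;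
      [apply Rmult_lt_0_compat; [assumption | apply exp_pos]|].
    unfold Rdiv at 1; rewrite Rmult_assoc, Rinv_l, Rmult_1_r.
    2: { apply Rgt_not_eq, Rmult_lt_0_compat; [assumption | apply exp_pos]. }
    eapply Rle_trans; [exact Hr|].
    set (A := Cmod (rising z (S (S n)))).
    replace (exp (Re (z + s) * L))%R with (exp (Re z * L) * exp (Re s * L))%R
      by (rewrite <- exp_plus; f_equal; unfold Re; simpl; ring).
    set (e1 := exp (Re z * L)).
    assert (0 < e1)%R by apply exp_pos.
    apply Rle_trans with (A * (exp (K * (/ w + 1)) * exp (- Re s * ln (Re z))
       * exp (Re s * (ln (Re z + INR (S (S n))) - L)) * exp (Re s * L)))%R;
      [|right; field; split; lra].
    apply Rmult_le_compat_l; [apply Cmod_ge_0|].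
    rewrite <- !exp_plus; apply exp_le_mono.
    pose proof (pos_INR (S (S n))).
    destruct (potential_bounds w (Re z) (Im z)); [lra|].
    destruct (potential_bounds w (Re z + INR (S (S n))) (Im z)); [lra|].
    assert (K * (potential (Im z) (Re z) - potential (Im z) (Re z + INR (S (S n))))
              <= K * (/ w + 1))%R by (apply Rmult_le_compat_l; lra).
    lra. }
  pose proof (proj1 (is_lim_seq_incr_1 _ _) (ccvg_Cmod _ _ (gauss_cvg (z + s)))) as L1.
  pose proof (proj1 (is_lim_seq_incr_1 _ _) (ccvg_Cmod _ _ (gauss_cvg z))) as L2.
  set (c := (exp (K * (/ w + 1)) * exp (- Re s * ln (Re z)))%R) in *.
  assert (is_lim_seq (fun n => Cmod (gauss z (S n)) * (c *
            exp (Re s * (ln (Re z + INR (S (S n))) - ln (INR (S n))))))%R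
            (Cmod (rGamma z) * (c * exp (Re s * 0)))%R) as L3.
  { apply is_lim_seq_mult'; [assumption|].
    apply is_lim_seq_mult'; [apply is_lim_seq_const|].
    apply (is_lim_seq_continuous exp);
      [apply derivable_continuous_pt, derivable_pt_exp|].
    apply is_lim_seq_mult'; [apply is_lim_seq_const|].
    now apply is_lim_seq_ln_ratio. }
  pose proof (is_lim_seq_le _ _ _ _ Hn L1 L3) as H; simpl in H.
  rewrite Rmult_0_r, exp_0 in H; lra.
Qed.

(** * Convergence of the Bessel-Maitland series *)

(** The ratio test for terms that may vanish, as they do when the argument of the
    Bessel-Maitland function is 0. *)
Lemma ex_series_ratio_to_0 (u e : nat -> R) :
  (forall n, 0 <= u n)%R -> is_lim_seq e 0%R ->
  (forall n, u (S n) <= e n * u n)%R -> ex_series u.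
Proof.
  intros Hu He H.
  apply is_lim_seq_spec in He.
  destruct (He (mkposreal (/ 2) ltac:(lra))) as [N HN]; simpl in HN.
  apply (ex_series_incr_n (V := R_NormedModule) u N).
  apply (ex_series_le (K := R_AbsRing) (V := R_CompleteNormedModule))
    with (b := fun k => (u N * (/ 2) ^ k)%R).
  - intros k; change (Rabs (u (N + k)%nat) <= u N * (/ 2) ^ k)%R.
    rewrite Rabs_pos_eq by apply Hu.
    induction k as [|k IH]; [rewrite Nat.add_0_r; simpl; lra|].
    rewrite Nat.add_succ_r; simpl.
    specialize (HN (N + k)%nat ltac:(lia)).
    rewrite Rminus_0_r in HN; apply Rabs_def2 in HN.
    eapply Rle_trans; [apply H|].
    pose proof (Hu (N + k)%nat); nra.
  - apply (ex_series_scal_l (V := R_NormedModule)).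
    apply ex_series_geom; rewrite Rabs_pos_eq; lra.
Qed.

Lemma ln_mono (x y : R) : (0 < x <= y)%R -> (ln x <= ln y)%R.
Proof. intros [Hx Hy]; now apply ln_le. Qed.

(** [rGamma_shift_bound] for the shift [- q], read for [Gamma = / rGamma]: along the
    points [g + q n] the imaginary part is constant, which is what negative shifts
    require. *)
Lemma Gamma_growth (g : C) (q : R) :
  (0 <= Re g)%R -> g <> 0 -> (0 <= q)%R ->
  exists K, (0 < K)%R /\ forall n,
    (Cmod (Gamma (g + RtoC (q * INR (S n)))) <=
     K * exp (q * ln (INR (S n))) * Cmod (Gamma (g + RtoC (q * INR n))))%R.
Proof.
  intros Hg Hg0 Hq.
  assert (forall n, g + RtoC (q * INR n) <> 0 /\ (0 <= Re (g + RtoC (q * INR n)))%R) as Hn.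
  { intros n; pose proof (pos_INR n).
    assert (0 <= q * INR n)%R by nra.
    assert (Re (g + RtoC (q * INR n)) = Re g + q * INR n)%R as E by reflexivity.
    split; [|rewrite E; lra].
    intros E0; rewrite E0 in E; simpl in E.
    assert (q * INR n = 0)%R as E1 by lra.
    apply Hg0; rewrite <- E0, E1; ring. }
  destruct Hq as [Hq|Hq].
  (* All the points [g + q (n + 1)] have real part at least [q]. *)
  - destruct (rGamma_shift_bound q (Rabs (Im g)) (RtoC (- q)) Hq) as [K [HK H]].
    exists (K * exp (q * ln (Re g + q)))%R; split.
    { apply Rmult_lt_0_compat; [assumption | apply exp_pos]. }
    intros n.
    destruct (Hn n) as [N1 N2], (Hn (S n)) as [N3 N4].
    pose proof (rGamma_neq0 _ N2 N1) as R1.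
    pose proof (rGamma_neq0 _ N4 N3) as R2.
    assert (Re (g + RtoC (q * INR (S n))) = Re g + q * INR (S n))%R as ER by reflexivity.
    pose proof (pos_INR n).
    specialize (H (g + RtoC (q * INR (S n)))).
    rewrite ER in H.
    replace (g + RtoC (q * INR (S n)) + RtoC (- q)) with (g + RtoC (q * INR n)) in H
      by (rewrite S_INR, !RtoC_mult, RtoC_opp, RtoC_plus; ring).
    unfold Gamma; rewrite !Cmod_inv by assumption.
    apply Cmod_gt_0 in R1; apply Cmod_gt_0 in R2.
    apply Rmult_le_reg_r with (Cmod (rGamma (g + RtoC (q * INR (S n)))));
      [assumption|].
    rewrite Rinv_l by lra.
    apply Rmult_le_reg_r with (Cmod (rGamma (g + RtoC (q * INR n)))); [assumption|].
    rewrite Rmult_1_l.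
    eapply Rle_trans; [apply H|].
    + rewrite S_INR; nra.
    + right; replace (Im (g + RtoC (q * INR (S n)))) with (Im g)
        by (unfold Im; simpl; ring).
      apply Rle_refl.
    + set (r1 := Cmod (rGamma (g + RtoC (q * INR n)))) in *.
      set (r2 := Cmod (rGamma (g + RtoC (q * INR (S n))))) in *.
      apply Rle_trans with (K * (exp (q * ln (Re g + q)) * exp (q * ln (INR (S n)))) * r2)%R;
        [|right; field; lra].
      apply Rmult_le_compat_r; [lra|]; apply Rmult_le_compat_l; [lra|].
      rewrite <- exp_plus; apply exp_le_mono.
      simpl Re; rewrite Ropp_involutive, <- Rmult_plus_distr_l, <- ln_mult;
        [|lra|apply INR_S_pos].
      apply Rmult_le_compat_l; [lra|]; apply ln_mono.
      rewrite S_INR; nra.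
  - subst q; exists 1%R; split; [lra|].
    intros n; rewrite !Rmult_0_l, exp_0; lra.
Qed.

(** [rGamma_shift_bound] for the shift [d]: as [Re d >= 0], the imaginary parts may
    be unbounded along the points [d n + w]. *)
Lemma rGamma_growth (d w : C) :
  (0 <= Re d)%R -> (0 < Re w)%R ->
  exists K, (0 < K)%R /\ forall n,
    (Cmod (rGamma (d * INR (S n) + w)) <=
     K * exp (- Re d * ln (INR (S n))) * Cmod (rGamma (d * INR n + w)))%R.
Proof.
  intros Hd Hw.
  destruct (rGamma_shift_bound (Re w) 0 d Hw) as [K [HK H]].
  assert (forall n, Re (d * INR n + w) = Re d * INR n + Re w)%R as ER
    by (intros n; simpl; unfold Re; ring).
  assert (exists K', 0 < K' /\ forall n, - Re d * ln (Re d * INR n + Re w)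
             <= ln K' + - Re d * ln (INR (S n)))%R as [K' [HK' HL]].
  { destruct Hd as [Hd|Hd].
    (* [Re d * n + Re w >= m (n + 1)]. *)
  - set (m := Rmin (Re d) (Re w)).
      assert (0 < m)%R as Hm by now apply Rmin_pos.
      assert (m <= Re d)%R by apply Rmin_l.
      assert (m <= Re w)%R by apply Rmin_r.
      exists (exp (- Re d * ln m)); split; [apply exp_pos|].
      intros n; rewrite ln_exp, <- Rmult_plus_distr_l, <- ln_mult;
        [|lra|apply INR_S_pos].
      apply Rmult_le_compat_neg_l; [lra|]; apply ln_mono.
      pose proof (INR_S_pos n); pose proof (pos_INR n).
      split; [nra|]; rewrite S_INR; nra.
    - exists 1%R; split; [lra|]; intros n; rewrite <- Hd, ln_1; lra. }
  exists (K * K')%R; split; [nra|].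
  intros n; pose proof (pos_INR n).
  replace (d * INR (S n) + w) with (d * INR n + w + d)
    by (rewrite S_INR, RtoC_plus; ring).
  eapply Rle_trans; [apply H|].
  - rewrite ER; nra.
  - now left.
  - rewrite ER; apply Rmult_le_compat_r; [apply Cmod_ge_0|].
    rewrite Rmult_assoc; apply Rmult_le_compat_l; [lra|].
    rewrite <- (exp_ln K' HK'), <- exp_plus.
    apply exp_le_mono, HL.
Qed.

(** The case [s = 0] agrees with the general formula because [Gamma g <> 0]. *)
Lemma pochhammer_eq (g : C) (s : R) :
  (0 <= Re g)%R -> g <> 0 -> pochhammer g s = Gamma (g + s) / Gamma g.
Proof.
  intros Hg Hg0; unfold pochhammer; destruct (Req_EM_T s 0) as [->|]; [|reflexivity].
  replace (g + 0) with g by ring.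
  pose proof (rGamma_neq0 g Hg Hg0); unfold Gamma; field; assumption.
Qed.

(** The ratio of consecutive terms is at most a multiple of
    [n ^ q * n ^ (- Re d) * n ^ (- 1)], whose exponent is negative by hypothesis. *)
Lemma bessel_maitland_abs_summable (v d g : C) (q : R) (z : C) :
  (0 <= q)%R -> (0 <= Re d)%R -> (-1 < Re v)%R -> (0 <= Re g)%R -> g <> 0 ->
  (Re d - q > -1)%R ->
  ex_series (fun n => Cmod (bessel_maitland_term v d g q z n)).
Proof.
  intros Hq Hd Hv Hg Hg0 Hdq.
  destruct (Gamma_growth g q Hg Hg0 Hq) as [K1 [HK1 H1]].
  destruct (rGamma_growth d (v + 1) Hd) as [K2 [HK2 H2]]; [simpl; unfold Re in *; lra|].
  set (e := fun n => (K1 * K2 * Cmod z * exp ((q - Re d - 1) * ln (INR (S n))))%R).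
  apply ex_series_ratio_to_0 with e.
  - intros n; apply Cmod_ge_0.
  - unfold e.
    replace (Finite 0%R) with (Finite (K1 * K2 * Cmod z * 0)%R) by (f_equal; ring).
    apply is_lim_seq_mult'; [apply is_lim_seq_const|].
    apply (is_lim_comp_seq exp _ m_infty); [apply is_lim_exp_m | exists O; discriminate|].
    apply is_lim_seq_mult with (Finite (q - Re d - 1)) p_infty;
      [apply is_lim_seq_const| |].
    + apply (is_lim_comp_seq ln _ p_infty); [apply is_lim_ln_p | exists O; discriminate|].
      apply (is_lim_seq_incr_1 INR), is_lim_seq_INR.
    + apply is_Rbar_mult_sym, is_Rbar_mult_p_infty_neg; simpl; lra.
  - intros n; unfold bessel_maitland_term.
    rewrite !pochhammer_eq by assumption.
    assert (Gamma g <> 0) as HG.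
    { pose proof (rGamma_neq0 g Hg Hg0) as H0; unfold Gamma; intros E.
      apply C1_nz; rewrite <- (Cinv_r _ H0), E; ring. }
    rewrite <- !Cplus_assoc.
    specialize (H1 n); specialize (H2 n).
    rewrite !Cmod_mult, !Cmod_div, !Cmod_mult, !Cmod_div
      by (assumption || apply fact_neq0).
    rewrite !Cmod_pow, Cmod_opp, !Cmod_R.
    rewrite fact_simpl, mult_INR, Rabs_mult.
    pose proof (INR_S_pos n) as Hp.
    rewrite (Rabs_pos_eq (INR (S n))) by lra.
    rewrite (Rabs_pos_eq (INR (fact n))) by apply pos_INR.
    pose proof (INR_fact_lt_0 n) as Hf.
    apply Cmod_gt_0 in HG.
    set (P := Cmod (Gamma (g + RtoC (q * INR (S n))))) in *.
    set (P0 := Cmod (Gamma (g + RtoC (q * INR n)))) in *.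
    set (Q := Cmod (rGamma (d * INR (S n) + (v + 1)))) in *.
    set (Q0 := Cmod (rGamma (d * INR n + (v + 1)))) in *.
    set (G := Cmod (Gamma g)) in *.
    assert (0 <= P /\ 0 <= Q)%R as [HP HQ] by (split; apply Cmod_ge_0).
    apply Rle_trans with
      ((P * Q) * (Cmod z ^ S n / (G * (INR (S n) * INR (fact n)))))%R;
      [right; field; lra|].
    apply Rle_trans with
      (((K1 * exp (q * ln (INR (S n))) * P0) * (K2 * exp (- Re d * ln (INR (S n))) * Q0))
        * (Cmod z ^ S n / (G * (INR (S n) * INR (fact n)))))%R.
    + apply Rmult_le_compat_r.
      * unfold Rdiv; apply Rmult_le_pos; [apply pow_le, Cmod_ge_0|].
        left; apply Rinv_0_lt_compat; repeat apply Rmult_lt_0_compat; assumption.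
      * apply Rmult_le_compat; assumption.
    + right; unfold e.
      replace ((q - Re d - 1) * ln (INR (S n)))%R
        with (q * ln (INR (S n)) + - Re d * ln (INR (S n)) + - ln (INR (S n)))%R by ring.
      rewrite !exp_plus, exp_Ropp, exp_ln by assumption.
      simpl pow; field; lra.
Qed.

(** * Complex functions of a real variable *)

Lemma norm_C_R (z : C) : norm (V := C_R_NormedModule) z = Cmod z.
Proof.
  unfold norm; simpl; unfold prod_norm, Cmod; simpl.
  unfold norm; simpl; unfold abs; simpl.
  f_equal; f_equal; rewrite !Rmult_1_r, <- Rabs_mult; apply Rabs_pos_eq; nra.
Qed.

(** Continuity and derivation are handled by components, where the calculus of real
    functions applies to complex products and powers.  [Ccontinuous_continuous] and
    [is_Cderive_is_derive] lead back to the normed module. *)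
Definition Ccontinuous (f : R -> C) (t : R) : Prop :=
  continuous (fun x => Re (f x)) t /\ continuous (fun x => Im (f x)) t.

Definition is_Cderive (f : R -> C) (t : R) (d : C) : Prop :=
  is_derive (fun x => Re (f x)) t (Re d) /\ is_derive (fun x => Im (f x)) t (Im d).

(** Writes a complex number as a combination of two fixed vectors, so that
    componentwise properties pass to the normed module by linearity. *)
Lemma C_split (z : C) :
  z = plus (G := C_R_NormedModule) (scal (V := C_R_NormedModule) (Re z) (1, 0)%R)
        (scal (V := C_R_NormedModule) (Im z) (0, 1)%R).
Proof.
  destruct z as [x y]; apply injective_projections; simpl;
    unfold plus, scal; simpl; unfold mult; simpl; ring.
Qed.

Lemma Ccontinuous_continuous (f : R -> C) (t : R) :
  Ccontinuous f t -> continuous (U := C_R_NormedModule) f t.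
Proof.
  intros [H1 H2].
  apply (continuous_ext (T := R_UniformSpace) (U := C_R_NormedModule)
    (fun x => plus (scal (V := C_R_NormedModule) (Re (f x)) (1, 0)%R)
                (scal (V := C_R_NormedModule) (Im (f x)) (0, 1)%R))).
  { intros x; symmetry; apply C_split. }
  apply (continuous_plus (V := C_R_NormedModule));
    now apply (continuous_scal_l (V := C_R_NormedModule)).
Qed.

Lemma is_Cderive_is_derive (f : R -> C) (t : R) (d : C) :
  is_Cderive f t d -> is_derive (V := C_R_NormedModule) f t d.
Proof.
  intros [H1 H2].
  apply (is_derive_ext (V := C_R_NormedModule)
    (fun x => plus (scal (V := C_R_NormedModule) (Re (f x)) (1, 0)%R)
                (scal (V := C_R_NormedModule) (Im (f x)) (0, 1)%R))).
  { intros x; symmetry; apply C_split. }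
  rewrite (C_split d).
  apply (is_derive_plus (V := C_R_NormedModule));
    now apply (is_derive_scal_l (V := C_R_NormedModule)).
Qed.

Lemma Ccontinuous_const (c : C) (t : R) : Ccontinuous (fun _ => c) t.
Proof. split; apply continuous_const. Qed.

Lemma Ccontinuous_plus (f g : R -> C) (t : R) :
  Ccontinuous f t -> Ccontinuous g t -> Ccontinuous (fun x => f x + g x) t.
Proof.
  intros [H1 H2] [H3 H4]; split; simpl.
  - now apply (continuous_plus (V := R_NormedModule) (fun x => Re (f x)) (fun x => Re (g x))).
  - now apply (continuous_plus (V := R_NormedModule) (fun x => Im (f x)) (fun x => Im (g x))).
Qed.

Lemma Ccontinuous_mult (f g : R -> C) (t : R) :
  Ccontinuous f t -> Ccontinuous g t -> Ccontinuous (fun x => f x * g x) t.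
Proof.
  intros [H1 H2] [H3 H4]; split; simpl.
  - apply (continuous_minus (V := R_NormedModule)
      (fun x => Re (f x) * Re (g x))%R (fun x => Im (f x) * Im (g x))%R);
      now apply (continuous_mult (K := R_AbsRing)).
  - apply (continuous_plus (V := R_NormedModule)
      (fun x => Re (f x) * Im (g x))%R (fun x => Im (f x) * Re (g x))%R);
      now apply (continuous_mult (K := R_AbsRing)).
Qed.

Lemma Ccontinuous_ext (f g : R -> C) (t : R) :
  (forall x, f x = g x) -> Ccontinuous f t -> Ccontinuous g t.
Proof.
  intros E [H1 H2]; split.
  - apply (continuous_ext (fun x => Re (f x))); [intros x; now rewrite E | exact H1].
  - apply (continuous_ext (fun x => Im (f x))); [intros x; now rewrite E | exact H2].
Qed.

Lemma is_Cderive_continuous (f : R -> C) (t : R) (d : C) :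
  is_Cderive f t d -> Ccontinuous f t.
Proof.
  intros [H1 H2]; split; apply (ex_derive_continuous (V := R_NormedModule));
    eexists; eassumption.
Qed.

Lemma is_Cderive_ext_val (f : R -> C) (t : R) (d d' : C) :
  d = d' -> is_Cderive f t d -> is_Cderive f t d'.
Proof. now intros ->. Qed.

Lemma is_Cderive_mult (f g : R -> C) (t : R) (df dg : C) :
  is_Cderive f t df -> is_Cderive g t dg ->
  is_Cderive (fun x => f x * g x) t (df * g t + f t * dg).
Proof.
  intros [H1 H2] [H3 H4]; split; simpl.
  - replace (fst df * fst (g t) - snd df * snd (g t) +
             (fst (f t) * fst dg - snd (f t) * snd dg))%R
      with ((Re df * Re (g t) + Re (f t) * Re dg)
            - (Im df * Im (g t) + Im (f t) * Im dg))%R by (unfold Re, Im; ring).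
    apply (is_derive_minus (V := R_NormedModule)
      (fun x => Re (f x) * Re (g x))%R (fun x => Im (f x) * Im (g x))%R);
      apply (is_derive_mult (K := R_AbsRing)); try assumption; intros; apply Rmult_comm.
  - replace (fst df * snd (g t) + snd df * fst (g t) +
             (fst (f t) * snd dg + snd (f t) * fst dg))%R
      with ((Re df * Im (g t) + Re (f t) * Im dg)
            + (Im df * Re (g t) + Im (f t) * Re dg))%R by (unfold Re, Im; ring).
    apply (is_derive_plus (V := R_NormedModule)
      (fun x => Re (f x) * Im (g x))%R (fun x => Im (f x) * Re (g x))%R);
      apply (is_derive_mult (K := R_AbsRing)); try assumption; intros; apply Rmult_comm.
Qed.

Lemma is_Cderive_cpower (u : R -> R) (s : C) (t du : R) :
  (0 < u t)%R -> is_derive u t du ->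
  is_Cderive (fun x => cpower (u x) s) t (s * RtoC (du / u t) * cpower (u t) s).
Proof.
  intros Hu Hd.
  assert (is_derive (fun x => ln (u x)) t (du / u t)%R) as HL.
  { apply (is_derive_comp (V := R_NormedModule) ln u t (/ u t)%R du); [|assumption].
    now apply is_derive_ln. }
  destruct s as [p q].
  assert (forall x, cpower x (p, q)
    = ((exp (p * ln x) * cos (q * ln x))%R, (exp (p * ln x) * sin (q * ln x))%R)) as E.
  { intros x; unfold cpower, cexp; simpl.
    replace (p * ln x - q * 0)%R with (p * ln x)%R by ring.
    replace (p * 0 + q * ln x)%R with (q * ln x)%R by ring.
    apply injective_projections; simpl; ring. }
  set (L := fun x => ln (u x)) in *.
  assert (is_derive L t (du / u t)%R) as HL' by exact HL.
  assert (ex_derive L t) as HX by (eexists; exact HL').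
  assert (Derive L t = (du / u t)%R) as HD by now apply is_derive_unique.
  rewrite E; split.
  - apply is_derive_ext with (fun x => exp (p * L x) * cos (q * L x))%R.
    { intros x; rewrite E; reflexivity. }
    auto_derive; [repeat split; assumption|].
    change (ln (u t)) with (L t); simpl.
    change (Derive (fun x => L x) t) with (Derive L t); rewrite HD; ring.
  - apply is_derive_ext with (fun x => exp (p * L x) * sin (q * L x))%R.
    { intros x; rewrite E; reflexivity. }
    auto_derive; [repeat split; assumption|].
    change (ln (u t)) with (L t); simpl.
    change (Derive (fun x => L x) t) with (Derive L t); rewrite HD; ring.
Qed.

(** * Improper integrals over the unit interval *)

(** The bound 1/2 keeps the lower endpoint below the upper one. *)
Lemma unit_filter (P : R * R -> Prop) :
  (forall a b : R, (0 < a < / 2)%R -> (/ 2 < b < 1)%R -> P (a, b)) ->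
  filter_prod (at_right 0) (at_left 1) P.
Proof.
  intros H.
  apply Filter_prod with (fun a => 0 < a < / 2)%R (fun b => / 2 < b < 1)%R.
  - exists (mkposreal (/ 2) ltac:(lra)); intros y Hy Hy0.
    apply Rabs_def2 in Hy; unfold minus, plus, opp in Hy; simpl in Hy; lra.
  - exists (mkposreal (/ 2) ltac:(lra)); intros y Hy Hy0.
    apply Rabs_def2 in Hy; unfold minus, plus, opp in Hy; simpl in Hy; lra.
  - exact H.
Qed.

(** Integrability of a majorant, up to both endpoints, is given by an explicit
    primitive: the Cauchy criterion for a dominated function then only involves the
    increments of [G]. *)
Definition has_primitive (g : R -> R) (I : R) : Prop :=
  exists (G : R -> R) (L0 L1 : R),
    (forall t, (0 < t < 1)%R -> is_derive G t (g t) /\ continuous g t) /\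
    filterlim G (at_right 0) (locally L0) /\ filterlim G (at_left 1) (locally L1) /\
    I = (L1 - L0)%R.

Lemma is_RInt_gen_of_is_RInt {V : CompleteNormedModule R_AbsRing}
    (f : R -> V) (H : R * R -> V) (l : V) :
  (forall a b : R, (0 < a < / 2)%R -> (/ 2 < b < 1)%R -> is_RInt f a b (H (a, b))) ->
  filterlim H (filter_prod (at_right 0) (at_left 1)) (locally l) ->
  is_RInt_gen f (at_right 0) (at_left 1) l.
Proof.
  intros HI HL P HP.
  pose proof (unit_filter (fun ab => is_RInt f (fst ab) (snd ab) (H ab)) HI) as H1.
  assert (filter_prod (at_right 0) (at_left 1) (fun ab => P (H ab))) as H2
    by exact (HL P HP).
  unfold filtermapi.
  apply (filter_imp (fun ab => is_RInt f (fst ab) (snd ab) (H ab) /\ P (H ab)));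
    [|exact (filter_and _ _ H1 H2)].
  intros ab Hab; now exists (H ab).
Qed.

Lemma is_RInt_gen_FTC {V : CompleteNormedModule R_AbsRing}
    (F f : R -> V) (L0 L1 : V) :
  (forall t, (0 < t < 1)%R -> is_derive F t (f t)) ->
  (forall t, (0 < t < 1)%R -> continuous f t) ->
  filterlim F (at_right 0) (locally L0) -> filterlim F (at_left 1) (locally L1) ->
  is_RInt_gen f (at_right 0) (at_left 1) (minus L1 L0).
Proof.
  intros HF Hf H0 H1.
  apply is_RInt_gen_of_is_RInt with (fun ab => minus (F (snd ab)) (F (fst ab))).
  - intros a b Ha Hb; simpl; apply is_RInt_derive; intros x;
      rewrite Rmin_left, Rmax_right by lra; intros Hx; [apply HF | apply Hf]; lra.
  - unfold minus.
    eapply filterlim_comp_2; [| |apply (filterlim_plus (V := V))].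
    + eapply filterlim_comp; [apply filterlim_snd | exact H1].
    + eapply filterlim_comp; [|apply (filterlim_opp (V := V))].
      eapply filterlim_comp; [apply filterlim_fst | exact H0].
Qed.

Lemma norm_RInt_le_primitive {V : CompleteNormedModule R_AbsRing}
    (f : R -> V) (g G : R -> R) (s t : R) :
  (forall t, (0 < t < 1)%R -> continuous f t) ->
  (forall t, (0 < t < 1)%R -> is_derive G t (g t) /\ continuous g t) ->
  (forall t, (0 < t < 1)%R -> norm (f t) <= g t)%R ->
  (0 < s < 1)%R -> (0 < t < 1)%R ->
  (norm (RInt f s t) <= Rabs (G t - G s))%R.
Proof.
  intros Hf HG Hfg.
  assert (forall s t, (0 < s < 1)%R -> (0 < t < 1)%R -> (s <= t)%R ->
            norm (RInt f s t) <= Rabs (G t - G s))%R as Hle.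
  { intros a b Ha Hb Hab; eapply Rle_trans; [|apply Rle_abs].
    apply norm_RInt_le with f g a b; [assumption| | |].
    - intros x Hx; apply Hfg; lra.
    - apply (RInt_correct (V := V)), (ex_RInt_continuous (V := V)).
      intros z; rewrite Rmin_left, Rmax_right by lra; intros; apply Hf; lra.
    - apply (is_RInt_derive (V := R_CompleteNormedModule)); intros x;
        rewrite Rmin_left, Rmax_right by lra; intros Hx; apply HG; lra. }
  intros Hs Ht; destruct (Rle_lt_dec s t) as [H|H]; [now apply Hle|].
  rewrite <- (opp_RInt_swap (V := V)), (norm_opp (K := R_AbsRing) (V := V)), Rabs_minus_sym.
  - apply Hle; lra.
  - apply (ex_RInt_continuous (V := V)).
    intros z; rewrite Rmin_left, Rmax_right by lra; intros; apply Hf; lra.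
Qed.

(** The difference of two integrals of [f] over nearby pairs of endpoints consists of
    two integrals near the ends, each bounded by an increment of the primitive of [g]. *)
Lemma is_RInt_gen_domination {V : CompleteNormedModule R_AbsRing}
    (f : R -> V) (g : R -> R) (I : R) :
  (forall t, (0 < t < 1)%R -> continuous f t) ->
  has_primitive g I ->
  (forall t, (0 < t < 1)%R -> norm (f t) <= g t)%R ->
  exists l, is_RInt_gen f (at_right 0) (at_left 1) l.
Proof.
  intros Hf (G & L0 & L1 & HG & H0 & H1 & _) Hfg.
  assert (forall a b, (0 < a < 1)%R -> (0 < b < 1)%R -> ex_RInt f a b) as Hex.
  { intros a b Ha Hb; apply (ex_RInt_continuous (V := V)).
    intros z Hz; apply Hf; revert Hz; unfold Rmin, Rmax; destruct (Rle_dec a b); lra. }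
  destruct (proj1 (filterlim_locally_cauchy
    (F := filter_prod (at_right 0) (at_left 1)) (fun ab => RInt f (fst ab) (snd ab))))
    as [l Hl].
  - intros eps.
    assert (0 < eps / 4)%R as He by (destruct eps; simpl; lra).
    pose proof (proj1 (filterlim_locally _ _) H0 (mkposreal _ He)) as B0.
    pose proof (proj1 (filterlim_locally _ _) H1 (mkposreal _ He)) as B1.
    exists (fun ab => ((0 < fst ab < / 2)%R /\ (/ 2 < snd ab < 1)%R) /\
      (Rabs (G (fst ab) - L0) < eps / 4)%R /\ (Rabs (G (snd ab) - L1) < eps / 4)%R).
    split.
    + apply filter_and; [now apply unit_filter|].
      apply Filter_prod with (1 := B0) (2 := B1); intros a b Ha Hb; split; assumption.
    + intros [a b] [a' b']; simpl; intros [[A1 A2] [A3 A4]] [[C1 C2] [C3 C4]].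
      apply (norm_compat1 (K := R_AbsRing) (V := V)).
      (* Chasles: only the pieces between [a'] and [a], and between [b'] and [b], remain. *)
      assert (minus (RInt f a' b') (RInt f a b)
              = plus (RInt f a' a) (opp (RInt f b' b))) as E.
      { rewrite <- (RInt_Chasles f a' a b') by (apply Hex; lra).
        rewrite <- (RInt_Chasles f a b b') by (apply Hex; lra).
        rewrite <- (opp_RInt_swap f b' b) by (apply Hex; lra).
        unfold minus; rewrite (plus_comm (RInt f a b)), <- !plus_assoc.
        rewrite (plus_opp_r (G := V)), plus_zero_r; reflexivity. }
      apply Rle_lt_trans with (norm (plus (RInt f a' a) (opp (RInt f b' b)))).
      { right; f_equal; exact E. }
      apply Rle_lt_trans with (Rabs (G a - G a') + Rabs (G b - G b'))%R.
      * eapply Rle_trans; [apply (norm_triangle (K := R_AbsRing) (V := V))|];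
          rewrite (norm_opp (K := R_AbsRing) (V := V)).
        apply Rplus_le_compat.
        -- apply (norm_RInt_le_primitive f g G a' a Hf HG Hfg); lra.
        -- apply (norm_RInt_le_primitive f g G b' b Hf HG Hfg); lra.
      * apply Rabs_def2 in A3; apply Rabs_def2 in A4.
        apply Rabs_def2 in C3; apply Rabs_def2 in C4.
        assert (Rabs (G a - G a') < eps / 2)%R by (apply Rabs_def1; lra).
        assert (Rabs (G b - G b') < eps / 2)%R by (apply Rabs_def1; lra).
        lra.
  - exists l; apply is_RInt_gen_of_is_RInt with (2 := Hl).
    intros a b Ha Hb; apply (RInt_correct (V := V)), Hex; simpl; lra.
Qed.

Lemma is_RInt_gen_primitive (g : R -> R) (I : R) :
  has_primitive g I -> is_RInt_gen (V := R_NormedModule) g (at_right 0) (at_left 1) I.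
Proof.
  intros (G & L0 & L1 & HG & H0 & H1 & ->).
  apply (is_RInt_gen_FTC (V := R_CompleteNormedModule) G); try assumption;
    intros t Ht; now apply HG.
Qed.

Lemma norm_RInt_gen_le (f : R -> C) (g : R -> R) (l : C) (I : R) :
  is_RInt_gen (V := C_R_NormedModule) f (at_right 0) (at_left 1) l ->
  is_RInt_gen (V := R_NormedModule) g (at_right 0) (at_left 1) I ->
  (forall t, (0 < t < 1)%R -> Cmod (f t) <= g t)%R ->
  (Cmod l <= I)%R.
Proof.
  intros Hf Hg H; rewrite <- norm_C_R.
  apply (RInt_gen_norm (V := C_R_CompleteNormedModule)
    (Fa := at_right 0) (Fb := at_left 1) f g); try assumption.
  - apply unit_filter; simpl; intros; lra.
  - apply unit_filter; simpl; intros a b Ha Hb x Hx; rewrite norm_C_R; apply H; lra.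
Qed.

(** Carries improper integrals through continuous linear maps; used for the real part
    and for multiplication by a complex constant. *)
Lemma is_RInt_gen_map {V W : NormedModule R_AbsRing} (phi : V -> W)
    (Fa Fb : (R -> Prop) -> Prop) (f : R -> V) (l : V) :
  Filter Fa -> Filter Fb ->
  (forall a b y, is_RInt f a b y -> is_RInt (fun t => phi (f t)) a b (phi y)) ->
  continuous phi l ->
  is_RInt_gen f Fa Fb l -> is_RInt_gen (fun t => phi (f t)) Fa Fb (phi l).
Proof.
  intros HFa HFb Hphi Hc Hf P HP.
  specialize (Hf (fun y => P (phi y)) (Hc P HP)).
  unfold filtermapi in *; revert Hf; apply filter_imp.
  intros ab [y [Hy1 Hy2]]; exists (phi y); split; [now apply Hphi | assumption].
Qed.

Definition cint01 (f : R -> C) (l : C) : Prop :=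
  is_RInt_gen (V := C_R_NormedModule) f (at_right 0) (at_left 1) l.

Lemma cint01_unique (f : R -> C) (l l' : C) : cint01 f l -> cint01 f l' -> l = l'.
Proof.
  intros H H'.
  rewrite <- (is_RInt_gen_unique (V := C_R_CompleteNormedModule) f l H).
  now apply (is_RInt_gen_unique (V := C_R_CompleteNormedModule)).
Qed.

Lemma cint01_ext (f g : R -> C) (l : C) :
  (forall t, (0 < t < 1)%R -> f t = g t) -> cint01 f l -> cint01 g l.
Proof.
  intros E; unfold cint01.
  apply (is_RInt_gen_ext (V := C_R_NormedModule) (Fa := at_right 0) (Fb := at_left 1) f g l).
  apply unit_filter; simpl; intros a b Ha Hb x.
  rewrite Rmin_left, Rmax_right by lra; intros; apply E; lra.
Qed.

Lemma cint01_plus (f g : R -> C) (l m : C) :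
  cint01 f l -> cint01 g m -> cint01 (fun t => f t + g t) (l + m).
Proof. exact (is_RInt_gen_plus (V := C_R_NormedModule) f g l m). Qed.

Lemma cint01_minus (f g : R -> C) (l m : C) :
  cint01 f l -> cint01 g m -> cint01 (fun t => f t - g t) (l - m).
Proof. exact (is_RInt_gen_minus (V := C_R_NormedModule) f g l m). Qed.

Lemma is_RInt_C_components (f : R -> C) (a b : R) (l : C) :
  is_RInt (V := C_R_NormedModule) f a b l <->
  is_RInt (fun t => Re (f t)) a b (Re l) /\ is_RInt (fun t => Im (f t)) a b (Im l).
Proof.
  split.
  - intros H; split.
    + apply (is_RInt_fct_extend_fst (U := R_NormedModule) (V := R_NormedModule) f a b l H).
    + apply (is_RInt_fct_extend_snd (U := R_NormedModule) (V := R_NormedModule) f a b l H).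
  - intros [H1 H2]; rewrite (surjective_pairing l).
    apply (is_RInt_fct_extend_pair (U := R_NormedModule) (V := R_NormedModule) f a b);
      assumption.
Qed.

Lemma is_RInt_Cscal (c : C) (f : R -> C) (a b : R) (l : C) :
  is_RInt (V := C_R_NormedModule) f a b l ->
  is_RInt (V := C_R_NormedModule) (fun t => c * f t) a b (c * l).
Proof.
  rewrite !is_RInt_C_components; intros [H1 H2]; split; simpl.
  - apply (is_RInt_minus (V := R_NormedModule)
      (fun t => fst c * Re (f t))%R (fun t => snd c * Im (f t))%R);
      now apply (is_RInt_scal (V := R_NormedModule)).
  - apply (is_RInt_plus (V := R_NormedModule)
      (fun t => fst c * Im (f t))%R (fun t => snd c * Re (f t))%R);
      now apply (is_RInt_scal (V := R_NormedModule)).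
Qed.

Lemma continuous_Re (l : C) :
  continuous (T := C_R_NormedModule) (U := R_NormedModule) (fun z : C => Re z) l.
Proof. destruct l; apply (continuous_fst (U := R_UniformSpace) (V := R_UniformSpace)). Qed.

Lemma continuous_Im (l : C) :
  continuous (T := C_R_NormedModule) (U := R_NormedModule) (fun z : C => Im z) l.
Proof. destruct l; apply (continuous_snd (U := R_UniformSpace) (V := R_UniformSpace)). Qed.

Lemma continuous_Cmult_l (c l : C) :
  continuous (T := C_R_NormedModule) (U := C_R_NormedModule) (fun z : C => c * z) l.
Proof.
  apply (continuous_ext (T := C_R_NormedModule) (U := C_R_NormedModule)
    (fun z : C => plus (scal (V := C_R_NormedModule) (Re z) c)
                    (scal (V := C_R_NormedModule) (Im z) (c * Ci)))).
  { intros z; destruct z as [x y], c as [a b]; apply injective_projections; simpl;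
      unfold plus, scal; simpl; unfold mult; simpl; ring. }
  apply (continuous_plus (U := C_R_NormedModule) (V := C_R_NormedModule));
    apply (continuous_scal_l (U := C_R_NormedModule) (V := C_R_NormedModule));
    [apply continuous_Re | apply continuous_Im].
Qed.

Lemma cint01_Cscal (c : C) (f : R -> C) (l : C) :
  cint01 f l -> cint01 (fun t => c * f t) (c * l).
Proof.
  apply (is_RInt_gen_map (V := C_R_NormedModule) (W := C_R_NormedModule)
    (fun z : C => c * z) (at_right 0) (at_left 1) f l _ _);
    [intros; now apply is_RInt_Cscal | apply continuous_Cmult_l].
Qed.

Lemma cint01_Re (f : R -> C) (l : C) :
  cint01 f l ->
  is_RInt_gen (V := R_NormedModule) (fun t => Re (f t)) (at_right 0) (at_left 1) (Re l).
Proof.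
  apply (is_RInt_gen_map (V := C_R_NormedModule) (W := R_NormedModule)
    (fun z : C => Re z) (at_right 0) (at_left 1) f l _ _); [|apply continuous_Re].
  intros a b y H; now apply is_RInt_C_components in H.
Qed.

Lemma cint01_domination (f : R -> C) (g : R -> R) (I : R) :
  (forall t, (0 < t < 1)%R -> Ccontinuous f t) -> has_primitive g I ->
  (forall t, (0 < t < 1)%R -> Cmod (f t) <= g t)%R ->
  exists l, cint01 f l.
Proof.
  intros Hf Hg H.
  apply (is_RInt_gen_domination (V := C_R_CompleteNormedModule) f g I); [|assumption|].
  - intros t Ht; now apply Ccontinuous_continuous, Hf.
  - intros t Ht; rewrite norm_C_R; auto.
Qed.

Lemma cint01_FTC (F f : R -> C) (L0 L1 : C) :
  (forall t, (0 < t < 1)%R -> is_Cderive F t (f t)) ->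
  (forall t, (0 < t < 1)%R -> Ccontinuous f t) ->
  filterlim F (at_right 0) (locally (T := C_R_NormedModule) L0) ->
  filterlim F (at_left 1) (locally (T := C_R_NormedModule) L1) ->
  cint01 f (L1 - L0).
Proof.
  intros HF Hf H0 H1.
  apply (is_RInt_gen_FTC (V := C_R_CompleteNormedModule) F f L0 L1); try assumption.
  - intros t Ht; now apply is_Cderive_is_derive, HF.
  - intros t Ht; now apply Ccontinuous_continuous, Hf.
Qed.

(** * Behaviour of powers at the endpoints *)

Lemma filterlim_power_0 {V : NormedModule R_AbsRing} (F : R -> V) (l : V) (r : R) :
  (0 < r)%R ->
  (forall t, (0 < t < 1)%R -> norm (minus (F t) l) <= exp (r * ln t))%R ->
  filterlim F (at_right 0) (locally l).
Proof.
  intros Hr HF; apply filterlim_locally; intros eps.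
  assert (0 < Rmin 1 (exp (ln eps / r)))%R as Hd by (apply Rmin_pos; [lra|apply exp_pos]).
  exists (mkposreal _ Hd); intros t Ht Ht0.
  apply Rabs_def2 in Ht; unfold minus, plus, opp in Ht; simpl in Ht.
  pose proof (Rmin_l 1 (exp (ln eps / r))); pose proof (Rmin_r 1 (exp (ln eps / r))).
  apply (norm_compat1 (K := R_AbsRing) (V := V)).
  eapply Rle_lt_trans; [apply HF; lra|].
  destruct eps as [e He]; simpl in *.
  rewrite <- (exp_ln e He); apply exp_increasing.
  assert (ln t < ln e / r)%R as Hlt.
  { rewrite <- (ln_exp (ln e / r)); apply ln_increasing; lra. }
  apply (Rmult_lt_compat_l r) in Hlt; [|assumption].
  replace (r * (ln e / r))%R with (ln e) in Hlt by (field; lra); lra.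
Qed.

Lemma filterlim_reflect_0 {V : UniformSpace} (F : R -> V) (l : V) :
  filterlim F (at_left 1) (locally l) ->
  filterlim (fun t => F (1 - t)%R) (at_right 0) (locally l).
Proof.
  intros H P HP; destruct (H P HP) as [d Hd]; exists d.
  intros t Ht Ht1; apply Hd; [|lra].
  apply Rabs_def2 in Ht; unfold minus, plus, opp in Ht; simpl in Ht.
  apply Rabs_def1; unfold minus, plus, opp; simpl; lra.
Qed.

Lemma filterlim_reflect_1 {V : UniformSpace} (F : R -> V) (l : V) :
  filterlim F (at_right 0) (locally l) ->
  filterlim (fun t => F (1 - t)%R) (at_left 1) (locally l).
Proof.
  intros H P HP; destruct (H P HP) as [d Hd]; exists d.
  intros t Ht Ht1; apply Hd; [|lra].
  apply Rabs_def2 in Ht; unfold minus, plus, opp in Ht; simpl in Ht.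
  apply Rabs_def1; unfold minus, plus, opp; simpl; lra.
Qed.

Lemma filterlim_power_1 {V : NormedModule R_AbsRing} (F : R -> V) (l : V) (r : R) :
  (0 < r)%R ->
  (forall t, (0 < t < 1)%R -> norm (minus (F t) l) <= exp (r * ln (1 - t)))%R ->
  filterlim F (at_left 1) (locally l).
Proof.
  intros Hr HF.
  apply filterlim_ext with (fun t => F (1 - (1 - t))%R).
  { intros t; f_equal; ring. }
  apply (filterlim_reflect_1 (fun t => F (1 - t)%R)), filterlim_power_0 with r;
    [assumption|].
  intros t Ht; replace t with (1 - (1 - t))%R at 2 by ring; apply HF; lra.
Qed.

Lemma has_primitive_scal (c : R) (g : R -> R) (I : R) :
  has_primitive g I -> has_primitive (fun t => c * g t)%R (c * I).
Proof.
  intros (G & L0 & L1 & HG & H0 & H1 & ->).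
  exists (fun t => c * G t)%R, (c * L0)%R, (c * L1)%R.
  split; [|split; [|split]].
  - intros t Ht; destruct (HG t Ht) as [D K]; split.
    + now apply (is_derive_scal G t c).
    + now apply (continuous_scal_r (V := R_NormedModule) c g).
  - eapply filterlim_comp; [exact H0|].
    apply (filterlim_scal_r (V := R_NormedModule) c L0).
  - eapply filterlim_comp; [exact H1|].
    apply (filterlim_scal_r (V := R_NormedModule) c L1).
  - ring.
Qed.

Lemma has_primitive_plus (g h : R -> R) (I J : R) :
  has_primitive g I -> has_primitive h J -> has_primitive (fun t => g t + h t)%R (I + J).
Proof.
  intros (G & L0 & L1 & HG & H0 & H1 & ->) (K & M0 & M1 & HK & N0 & N1 & ->).
  exists (fun t => G t + K t)%R, (L0 + M0)%R, (L1 + M1)%R.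
  split; [|split; [|split]].
  - intros t Ht; destruct (HG t Ht) as [D1 C1], (HK t Ht) as [D2 C2]; split.
    + now apply (is_derive_plus (V := R_NormedModule) G K).
    + now apply (continuous_plus (V := R_NormedModule) g h).
  - eapply filterlim_comp_2; [exact H0|exact N0|].
    apply (filterlim_plus (V := R_NormedModule)).
  - eapply filterlim_comp_2; [exact H1|exact N1|].
    apply (filterlim_plus (V := R_NormedModule)).
  - ring.
Qed.

Lemma has_primitive_reflect (g : R -> R) (I : R) :
  has_primitive g I -> has_primitive (fun t => g (1 - t)%R) I.
Proof.
  intros (G & L0 & L1 & HG & H0 & H1 & ->).
  exists (fun t => -1 * G (1 - t))%R, (-1 * L1)%R, (-1 * L0)%R.
  assert (forall t, is_derive (fun t => 1 - t)%R t (-1)%R) as D1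
    by (intros t; auto_derive; [trivial | ring]).
  split; [|split; [|split]].
  - intros t Ht; destruct (HG (1 - t)%R ltac:(lra)) as [D C]; split.
    + replace (g (1 - t)%R) with (-1 * (-1 * g (1 - t)))%R by ring.
      apply (is_derive_scal (fun t => G (1 - t)%R)).
      apply (is_derive_comp (V := R_NormedModule) G (fun t => 1 - t)%R);
        [exact D | apply D1].
    + apply (continuous_comp (fun t => 1 - t)%R g); [|exact C].
      apply (ex_derive_continuous (V := R_NormedModule)); eexists; apply D1.
  - eapply filterlim_comp; [apply filterlim_reflect_0, H1|].
    apply (filterlim_scal_r (V := R_NormedModule) (-1)%R L1).
  - eapply filterlim_comp; [apply filterlim_reflect_1, H0|].
    apply (filterlim_scal_r (V := R_NormedModule) (-1)%R L0).
  - ring.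
Qed.

Lemma has_primitive_power (r : R) :
  (0 < r)%R -> has_primitive (fun t => r * exp ((r - 1) * ln t))%R 1.
Proof.
  intros Hr; exists (fun t => exp (r * ln t)), 0%R, 1%R.
  split; [|split; [|split]].
  - intros t Ht; split.
    + replace ((r - 1) * ln t)%R with (r * ln t + - ln t)%R by ring.
      rewrite exp_plus, exp_Ropp, exp_ln by lra.
      auto_derive; [lra|]; field; lra.
    + apply (ex_derive_continuous (V := R_NormedModule)); auto_derive; lra.
  - apply (filterlim_power_0 (V := R_NormedModule)) with r; [assumption|].
    intros t Ht; change (Rabs (exp (r * ln t) - 0) <= exp (r * ln t))%R.
    rewrite Rminus_0_r, Rabs_pos_eq; [lra | left; apply exp_pos].
  - eapply filterlim_filter_le_1; [apply filter_le_within|].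
    replace 1%R with (exp (r * ln 1)) at 2 by (rewrite ln_1, Rmult_0_r; apply exp_0).
    apply (ex_derive_continuous (V := R_NormedModule) (fun t => exp (r * ln t))).
    auto_derive; lra.
  - ring.
Qed.

(** * Euler's Beta integral *)

Definition beta_kernel (al z : C) (t : R) : C :=
  cpower (1 - t) (al - 1) * cpower t (z - 1).

Lemma Cmod_beta_kernel (al z : C) (t : R) :
  Cmod (beta_kernel al z t)
  = (exp ((Re al - 1) * ln (1 - t)) * exp ((Re z - 1) * ln t))%R.
Proof. unfold beta_kernel; rewrite Cmod_mult, !Cmod_cpower; reflexivity. Qed.

Definition beta_majorant (p r t : R) : R :=
  (r * exp ((r - 1) * ln t) + p * exp ((p - 1) * ln (1 - t)))%R.

Lemma has_primitive_beta_majorant (p r : R) :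
  (0 < p)%R -> (0 < r)%R -> has_primitive (beta_majorant p r) (1 + 1).
Proof.
  intros Hp Hr; apply has_primitive_plus; [now apply has_primitive_power|].
  now apply (has_primitive_reflect (fun t => p * exp ((p - 1) * ln t))%R),
    has_primitive_power.
Qed.

Lemma exp_ln_bounded (c u : R) :
  (/ 2 <= u <= 1)%R -> (exp (c * ln u) <= exp (Rabs c * ln 2))%R.
Proof.
  intros Hu; apply exp_le_mono.
  assert (- ln 2 <= ln u)%R by (rewrite <- ln_Rinv by lra; apply ln_le; lra).
  assert (ln u <= 0)%R by (rewrite <- ln_1; apply ln_le; lra).
  pose proof (Rle_abs c); pose proof (Rle_abs (- c)) as H'.
  rewrite Rabs_Ropp in H'; pose proof (Rabs_pos c).
  nra.
Qed.

(** On each half of the interval one of the two powers is bounded, so that a product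
    of powers is dominated by a sum of powers, which has an elementary primitive. *)
Lemma beta_kernel_dominated (p r : R) :
  (0 < p)%R -> (0 < r)%R -> exists M, (0 < M)%R /\ forall t, (0 < t < 1)%R ->
  (exp ((p - 1) * ln (1 - t)) * exp ((r - 1) * ln t) <= M * beta_majorant p r t)%R.
Proof.
  intros Hp Hr.
  set (M1 := (exp (Rabs (p - 1) * ln 2) / r)%R).
  set (M2 := (exp (Rabs (r - 1) * ln 2) / p)%R).
  assert (0 < M1)%R by (apply Rdiv_lt_0_compat; [apply exp_pos | assumption]).
  assert (0 < M2)%R by (apply Rdiv_lt_0_compat; [apply exp_pos | assumption]).
  exists (M1 + M2)%R; split; [lra|].
  intros t Ht; unfold beta_majorant.
  pose proof (exp_pos ((p - 1) * ln (1 - t))) as E1.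
  pose proof (exp_pos ((r - 1) * ln t)) as E2.
  set (a := exp ((p - 1) * ln (1 - t))) in *.
  set (b := exp ((r - 1) * ln t)) in *.
  assert (0 <= M1 * (r * b))%R by (apply Rmult_le_pos; [lra | apply Rmult_le_pos; lra]).
  assert (0 <= M1 * (p * a))%R by (apply Rmult_le_pos; [lra | apply Rmult_le_pos; lra]).
  assert (0 <= M2 * (r * b))%R by (apply Rmult_le_pos; [lra | apply Rmult_le_pos; lra]).
  assert (0 <= M2 * (p * a))%R by (apply Rmult_le_pos; [lra | apply Rmult_le_pos; lra]).
  destruct (Rle_lt_dec t (/ 2)).
  - assert (a * b <= M1 * (r * b))%R; [|lra].
    replace (M1 * (r * b))%R with (exp (Rabs (p - 1) * ln 2) * b)%R
      by (unfold M1; field; lra).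
    apply Rmult_le_compat_r; [lra|]; apply exp_ln_bounded; lra.
  - assert (a * b <= M2 * (p * a))%R; [|lra].
    replace (M2 * (p * a))%R with (a * exp (Rabs (r - 1) * ln 2))%R
      by (unfold M2; field; lra).
    apply Rmult_le_compat_l; [lra|]; apply exp_ln_bounded; lra.
Qed.

Lemma is_Cderive_cpower_id (s : C) (t : R) :
  (0 < t)%R -> is_Cderive (fun x => cpower x s) t (s * RtoC (1 / t) * cpower t s).
Proof.
  intros Ht; apply (is_Cderive_cpower (fun x => x)); [assumption|].
  apply (is_derive_id (K := R_AbsRing)).
Qed.

Lemma is_Cderive_cpower_compl (s : C) (t : R) :
  (t < 1)%R ->
  is_Cderive (fun x => cpower (1 - x) s) t (s * RtoC (-1 / (1 - t)) * cpower (1 - t) s).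
Proof.
  intros Ht; apply (is_Cderive_cpower (fun x => 1 - x)%R); [lra|].
  auto_derive; [trivial | ring].
Qed.

Lemma Ccontinuous_beta_kernel (al z : C) (t : R) :
  (0 < t < 1)%R -> Ccontinuous (beta_kernel al z) t.
Proof.
  intros Ht; apply Ccontinuous_mult; eapply is_Cderive_continuous;
    [apply is_Cderive_cpower_compl | apply is_Cderive_cpower_id]; lra.
Qed.

Definition Beta (al z : C) : C :=
  RInt_gen (V := C_R_CompleteNormedModule) (beta_kernel al z) (at_right 0) (at_left 1).

Lemma Beta_correct (al z : C) :
  (0 < Re al)%R -> (0 < Re z)%R -> cint01 (beta_kernel al z) (Beta al z).
Proof.
  intros Ha Hz.
  destruct (beta_kernel_dominated (Re al) (Re z) Ha Hz) as [M [HM H]].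
  destruct (cint01_domination (beta_kernel al z)
    (fun t => M * beta_majorant (Re al) (Re z) t)%R (M * (1 + 1))%R) as [l Hl].
  - intros t Ht; now apply Ccontinuous_beta_kernel.
  - now apply has_primitive_scal, has_primitive_beta_majorant.
  - intros t Ht; rewrite Cmod_beta_kernel; now apply H.
  - unfold Beta.
    rewrite (is_RInt_gen_unique (V := C_R_CompleteNormedModule) _ l Hl); exact Hl.
Qed.

Lemma exp_ln_le_1 (c u : R) : (0 <= c)%R -> (0 < u <= 1)%R -> (exp (c * ln u) <= 1)%R.
Proof.
  intros Hc Hu; rewrite <- exp_0; apply exp_le_mono.
  assert (ln u <= 0)%R by (rewrite <- ln_1; apply ln_le; lra); nra.
Qed.

(** Integration of the derivative of [(1 - t) ^ al * t ^ z], which vanishes at both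
    ends. *)
Lemma Beta_step (al z : C) :
  (0 < Re al)%R -> (0 < Re z)%R -> z * Beta al z = (z + al) * Beta al (z + 1).
Proof.
  intros Ha Hz.
  assert (0 < Re (z + 1))%R as Hz1 by (simpl; unfold Re in *; lra).
  pose proof (Beta_correct al z Ha Hz) as B0.
  pose proof (Beta_correct al (z + 1) Ha Hz1) as B1.
  set (f := fun t => - al * beta_kernel al (z + 1) t
              + z * (beta_kernel al z t - beta_kernel al (z + 1) t)).
  assert (cint01 f (- al * Beta al (z + 1) + z * (Beta al z - Beta al (z + 1)))) as I1.
  { apply cint01_plus; apply cint01_Cscal; [assumption|].
    now apply cint01_minus. }
  assert (cint01 f (RtoC 0 - RtoC 0)) as I2.
  { apply cint01_FTC with (fun t => cpower (1 - t) al * cpower t z).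
    - intros t Ht; eapply is_Cderive_ext_val;
        [|apply is_Cderive_mult;
          [apply is_Cderive_cpower_compl | apply is_Cderive_cpower_id]; lra].
      unfold f, beta_kernel.
      replace (z + 1 - 1) with z by ring.
      rewrite (cpower_pred t z), (cpower_pred (1 - t) al) by lra.
      assert (RtoC t <> 0) as T0 by (apply RtoC_neq0; lra).
      assert (RtoC (1 - t) <> 0) as T1 by (apply RtoC_neq0; lra).
      rewrite !RtoC_div by lra.
      rewrite RtoC_minus in *; field; split; assumption.
    - intros t Ht.
      apply Ccontinuous_plus; apply Ccontinuous_mult; try apply Ccontinuous_const.
      + now apply Ccontinuous_beta_kernel.
      + apply Ccontinuous_plus; [now apply Ccontinuous_beta_kernel|].
        apply (Ccontinuous_ext (fun t => -(1) * beta_kernel al (z + 1) t));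
          [intros; ring|].
        apply Ccontinuous_mult; [apply Ccontinuous_const|].
        now apply Ccontinuous_beta_kernel.
    - apply (filterlim_power_0 (V := C_R_NormedModule)) with (Re z); [assumption|].
      intros t Ht; rewrite norm_C_R.
      change (Cmod (cpower (1 - t) al * cpower t z - 0) <= exp (Re z * ln t))%R.
      rewrite Cminus_0_r, Cmod_mult, !Cmod_cpower.
      rewrite <- (Rmult_1_l (exp (Re z * ln t))) at 2.
      apply Rmult_le_compat_r; [left; apply exp_pos | apply exp_ln_le_1; lra].
    - apply (filterlim_power_1 (V := C_R_NormedModule)) with (Re al); [assumption|].
      intros t Ht; rewrite norm_C_R.
      change (Cmod (cpower (1 - t) al * cpower t z - 0) <= exp (Re al * ln (1 - t)))%R.
      rewrite Cminus_0_r, Cmod_mult, !Cmod_cpower.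
      rewrite <- (Rmult_1_r (exp (Re al * ln (1 - t)))) at 2.
      apply Rmult_le_compat_l; [left; apply exp_pos | apply exp_ln_le_1; lra]. }
  pose proof (cint01_unique _ _ _ I1 I2) as E.
  replace (z * Beta al z)
    with ((- al * Beta al (z + 1) + z * (Beta al z - Beta al (z + 1)))
          + (z + al) * Beta al (z + 1)) by ring.
  rewrite E; ring.
Qed.

Lemma Beta_1_r (al : C) : (0 < Re al)%R -> al * Beta al 1 = 1.
Proof.
  intros Ha.
  assert (0 < Re 1)%R as H1 by (simpl; lra).
  pose proof (cint01_Cscal (- al) _ _ (Beta_correct al 1 Ha H1)) as I1.
  assert (cint01 (fun t => - al * beta_kernel al 1 t) (RtoC 0 - RtoC 1)) as I2.
  { apply cint01_FTC with (fun t => cpower (1 - t) al).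
    - intros t Ht; eapply is_Cderive_ext_val;
        [|apply is_Cderive_cpower_compl; lra].
      unfold beta_kernel.
      replace (cpower t (1 - 1)) with (RtoC 1).
      2: { unfold cpower; replace ((1 - 1) * ln t) with (RtoC 0) by ring.
           now rewrite cexp_0. }
      rewrite (cpower_pred (1 - t) al) by lra.
      assert (RtoC (1 - t) <> 0) as T1 by (apply RtoC_neq0; lra).
      rewrite !RtoC_div by lra.
      field; assumption.
    - intros t Ht.
      apply Ccontinuous_mult; [apply Ccontinuous_const|].
      now apply Ccontinuous_beta_kernel.
    - eapply filterlim_filter_le_1; [apply filter_le_within|].
      replace (RtoC 1) with (cpower (1 - 0) al).
      2: { unfold cpower; rewrite Rminus_0_r, ln_1, Cmult_0_r; apply cexp_0. }
      apply (Ccontinuous_continuous (fun t => cpower (1 - t) al) 0).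
      eapply is_Cderive_continuous, is_Cderive_cpower_compl; lra.
    - apply (filterlim_power_1 (V := C_R_NormedModule)) with (Re al); [assumption|].
      intros t Ht; rewrite norm_C_R.
      change (Cmod (cpower (1 - t) al - 0) <= exp (Re al * ln (1 - t)))%R.
      rewrite Cminus_0_r, Cmod_cpower; lra. }
  pose proof (cint01_unique _ _ _ I1 I2) as E.
  replace (al * Beta al 1) with (- (- al * Beta al 1)) by ring.
  rewrite E; ring.
Qed.

Lemma Re_plus_nat (z : C) (n : nat) : Re (z + INR n) = (Re z + INR n)%R.
Proof. reflexivity. Qed.

Lemma Beta_shift (al z : C) (n : nat) :
  (0 < Re al)%R -> (0 < Re z)%R ->
  Beta al z * rising z n = rising (z + al) n * Beta al (z + INR n).
Proof.
  intros Ha Hz; induction n as [|n IH].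
  - simpl; replace (z + 0) with z by ring; ring.
  - simpl rising; rewrite Cmult_assoc, IH.
    pose proof (pos_INR n).
    assert (0 < Re (z + INR n))%R as Hn by (rewrite Re_plus_nat; lra).
    pose proof (Beta_step al (z + INR n) Ha Hn) as S.
    rewrite S_INR, RtoC_plus, Cplus_assoc.
    transitivity (rising (z + al) n * ((z + INR n) * Beta al (z + INR n))); [ring|].
    rewrite S; ring.
Qed.

Lemma Beta_nat (al : C) (n : nat) :
  (0 < Re al)%R -> rising al (S n) * Beta al (INR n + 1) = INR (fact n).
Proof.
  intros Ha; induction n as [|n IH].
  - simpl; replace (0 + 1) with (RtoC 1) by ring.
    transitivity (al * Beta al 1); [ring|]; now apply Beta_1_r.
  - change (rising al (S (S n))) with (rising al (S n) * (al + INR (S n))).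
    rewrite fact_simpl, mult_INR, RtoC_mult, <- IH.
    rewrite S_INR, RtoC_plus.
    pose proof (pos_INR n).
    assert (0 < Re (INR n + 1))%R as Hn by (simpl; lra).
    pose proof (Beta_step al (INR n + 1) Ha Hn) as S.
    transitivity (rising al (Datatypes.S n) * ((INR n + 1) * Beta al (INR n + 1))); [|ring].
    rewrite S; ring.
Qed.

(** At integers the recurrence ends at [Beta al 1 = / al], so that the Beta integral is
    the reciprocal of Gauss's product.  This is where Gauss's definition of [Gamma] meets the integral. *)
Lemma cpower_Beta_nat (al : C) (n : nat) :
  (0 < Re al)%R -> cpower (INR n) al * Beta al (INR n + 1) = / gauss al n.
Proof.
  intros Ha; unfold gauss.
  assert (rising al (S n) <> 0) as Hr
    by (apply rising_neq0; [lra | now apply neq0_of_Re_pos]).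
  pose proof (fact_neq0 n) as Hf; pose proof (cpower_neq0 (INR n) al) as Hc.
  pose proof (Beta_nat al n Ha) as HB.
  rewrite <- HB in *.
  assert (Beta al (INR n + 1) <> 0) as Hb.
  { intros E; apply Hf; rewrite E; ring. }
  field; repeat split; assumption.
Qed.

Lemma neg_ln_le (t : R) : (0 < t < 1)%R -> (0 <= - ln t <= (1 - t) / t)%R.
Proof.
  intros Ht; split.
  - assert (ln t <= 0)%R by (rewrite <- ln_1; apply ln_le; lra); lra.
  - assert (0 < / t)%R by (apply Rinv_0_lt_compat; lra).
    rewrite <- ln_Rinv by lra.
    pose proof (exp_ge_1_plus (/ t - 1)) as H1.
    apply Rle_trans with (/ t - 1)%R; [|right; field; lra].
    rewrite <- (ln_exp (/ t - 1)); apply ln_le; lra.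
Qed.

(** For large [n] the kernel concentrates near [t = 1], where [t ^ z - 1] is
    [O (1 - t)]: the factor [1 - t] raises [al] by 1, and this gains a factor [1 / n]. *)
Lemma Beta_diff_bound (al z : C) (n : nat) :
  (0 < Re al)%R -> (0 < Re z)%R -> (1 <= n)%nat ->
  (Cmod (Beta al (z + INR n + 1) - Beta al (INR n + 1))
     <= 3 * Cmod z * Cmod (Beta (RtoC (Re al + 1)) (INR n)))%R.
Proof.
  intros Ha Hz Hn.
  assert (1 <= INR n)%R as Hn1 by (apply (le_INR 1), Hn).
  assert (0 < Re (z + INR n + 1))%R as P1 by (simpl; unfold Re in *; lra).
  assert (0 < Re (INR n + 1))%R as P2 by (simpl; lra).
  assert (0 < Re (RtoC (Re al + 1)))%R as P3 by (simpl; unfold Re in *; lra).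
  assert (0 < Re (INR n))%R as P4 by (simpl; lra).
  pose proof (cint01_minus _ _ _ _ (Beta_correct al _ Ha P1) (Beta_correct al _ Ha P2)) as I1.
  pose proof (Beta_correct _ _ P3 P4) as I2.
  apply cint01_Re in I2.
  apply (is_RInt_gen_scal (V := R_NormedModule) _ (3 * Cmod z)%R) in I2.
  eapply Rle_trans; [eapply norm_RInt_gen_le; [exact I1 | exact I2 |]|].
  2: { apply Rmult_le_compat_l; [pose proof (Cmod_ge_0 z); lra | apply Cmod_ge_Re]. }
  intros t Ht.
  change (Cmod (beta_kernel al (z + INR n + 1) t - beta_kernel al (INR n + 1) t)
    <= 3 * Cmod z * Re (beta_kernel (RtoC (Re al + 1)) (INR n) t))%R.
  replace (Re (beta_kernel (RtoC (Re al + 1)) (INR n) t))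
    with (exp (Re al * ln (1 - t)) * exp ((INR n - 1) * ln t))%R.
  2: { unfold beta_kernel, cpower.
       replace ((RtoC (Re al + 1) - 1) * ln (1 - t)) with (RtoC (Re al * ln (1 - t)))
         by (rewrite RtoC_plus, RtoC_mult; ring).
       replace ((INR n - 1) * ln t) with (RtoC ((INR n - 1) * ln t))
         by (rewrite RtoC_mult, RtoC_minus; ring).
       rewrite !cexp_RtoC, <- RtoC_mult; reflexivity. }
  unfold beta_kernel.
  replace (INR n + 1 - 1) with (RtoC (INR n)) by ring.
  replace (z + INR n + 1 - 1) with (INR n + z) by ring.
  rewrite cpower_plus.
  replace (cpower (1 - t) (al - 1) * (cpower t (INR n) * cpower t z)
           - cpower (1 - t) (al - 1) * cpower t (INR n))
    with (cpower (1 - t) (al - 1) * cpower t (INR n) * (cexp (z * ln t) - 1))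
    by (unfold cpower at 5; ring).
  rewrite !Cmod_mult, !Cmod_cpower.
  destruct (neg_ln_le t Ht) as [L1 L2].
  assert (Cmod (cexp (z * ln t) - 1) <= 3 * Cmod z * ((1 - t) / t))%R as HE.
  { eapply Rle_trans; [apply cexp_first_order|].
    - simpl; unfold Re in *; nra.
    - rewrite Cmod_mult, Cmod_R, Rabs_left1 by lra.
      pose proof (Cmod_ge_0 z); nra. }
  replace (Re (al - 1)) with (Re al - 1)%R by reflexivity.
  replace (Re (INR n)) with (INR n) by reflexivity.
  replace (Re al * ln (1 - t))%R with ((Re al - 1) * ln (1 - t) + ln (1 - t))%R by ring.
  replace ((INR n - 1) * ln t)%R with (INR n * ln t + - ln t)%R by ring.
  rewrite !exp_plus, exp_Ropp, !exp_ln by lra.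
  pose proof (exp_pos ((Re al - 1) * ln (1 - t))).
  pose proof (exp_pos (INR n * ln t)).
  set (a := exp ((Re al - 1) * ln (1 - t))) in *.
  set (b := exp (INR n * ln t)) in *.
  replace (3 * Cmod z * (a * (1 - t) * (b * / t)))%R
    with (a * b * (3 * Cmod z * ((1 - t) / t)))%R by (field; lra).
  apply Rmult_le_compat_l; [nra | exact HE].
Qed.

(** True at integers by [cpower_Beta_nat]; [Beta_diff_bound] shows that replacing the
    integer [n + 1] by [z + n + 1] does not change the limit. *)
Lemma cpower_Beta_cvg (al z : C) :
  (0 < Re al)%R -> (0 < Re z)%R ->
  ccvg (fun n => cpower (INR n) al * Beta al (z + INR n + 1)) (Gamma al).
Proof.
  intros Ha Hz.
  pose proof (neq0_of_Re_pos al Ha) as Ha0.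
  set (p1 := RtoC (Re al + 1)).
  assert (0 < Re p1)%R as Hp1 by (simpl; unfold Re in *; lra).
  (* The difference is [O (n ^ (Re al) * B (Re al + 1, n))], that is [O (1 / n)]; the
     recurrence moves [n] to [n + 1], where [cpower_Beta_nat] applies. *)
  assert (ccvg (fun n => cpower (INR n) al *
            (Beta al (z + INR n + 1) - Beta al (INR n + 1))) 0) as HD.
  { apply ccvg_of_Cmod.
    apply (is_lim_seq_incr_1 (fun n => Cmod (cpower (INR n) al *
            (Beta al (z + INR n + 1) - Beta al (INR n + 1)) - 0))).
    apply is_lim_seq_le_le with (fun _ => 0%R)
      (fun n => 3 * Cmod z * (Cmod (p1 + 1) * (/ INR (S n) * Cmod (/ gauss p1 (S n)))))%R.
    - intros n; split; [apply Cmod_ge_0|].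
      rewrite Cminus_0_r, Cmod_mult.
      pose proof (INR_S_pos n) as Hn.
      assert (1 <= INR (S n))%R as Hn1 by (apply (le_INR 1); lia).
      assert (0 < Re (INR (S n)))%R as P4 by exact Hn.
      eapply Rle_trans; [apply Rmult_le_compat_l; [apply Cmod_ge_0|]|].
      { apply Beta_diff_bound; [assumption|assumption|lia]. }
      rewrite <- cpower_Beta_nat by assumption.
      pose proof (Beta_step p1 (INR (S n)) Hp1 P4) as S.
      apply (f_equal Cmod) in S; rewrite !Cmod_mult, Cmod_R, Rabs_pos_eq in S by lra.
      rewrite Cmod_mult, !Cmod_cpower.
      replace (Re p1 * ln (INR (Datatypes.S n)))%R
        with (Re al * ln (INR (Datatypes.S n)) + ln (INR (Datatypes.S n)))%R
        by (unfold p1; simpl Re; ring).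
      rewrite exp_plus, exp_ln by assumption.
      set (m := INR (Datatypes.S n)) in *.
      set (e := exp (Re al * ln m)); assert (0 < e)%R by apply exp_pos.
      fold p1.
      set (b0 := Cmod (Beta p1 m)) in *; set (b1 := Cmod (Beta p1 (m + 1))) in *.
      assert (0 <= b1)%R by apply Cmod_ge_0.
      assert (b0 <= Cmod (p1 + 1) * b1)%R as Hb.
      { apply Rmult_le_reg_l with m; [assumption|]; rewrite S.
        replace (m * (Cmod (p1 + 1) * b1))%R with (m * Cmod (p1 + 1) * b1)%R by ring.
        apply Rmult_le_compat_r; [assumption|].
        replace (m + p1) with (RtoC (m + (Re al + 1)))
          by (unfold p1; rewrite RtoC_plus; ring).
        replace (p1 + 1) with (RtoC (Re al + 1 + 1))
          by (unfold p1; rewrite !RtoC_plus; ring).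
        rewrite !Cmod_R, !Rabs_pos_eq by lra.
        nra. }
      replace (3 * Cmod z * (Cmod (p1 + 1) * (/ m * (e * m * b1))))%R
        with (e * (3 * Cmod z * (Cmod (p1 + 1) * b1)))%R by (field; lra).
      apply Rmult_le_compat_l; [lra|].
      apply Rmult_le_compat_l; [pose proof (Cmod_ge_0 z); lra | exact Hb].
    - apply is_lim_seq_const.
    - replace (Finite 0%R)
        with (Finite (3 * Cmod z * (Cmod (p1 + 1) * (0 * Cmod (Gamma p1))))%R)
        by (f_equal; ring).
      apply is_lim_seq_mult'; [apply is_lim_seq_const|].
      apply is_lim_seq_mult'; [apply is_lim_seq_const|].
      apply is_lim_seq_mult'; [apply is_lim_seq_inv_S|].
      apply (is_lim_seq_incr_1 (fun n => Cmod (/ gauss p1 n))).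
      apply ccvg_Cmod, inv_gauss_cvg; [lra | now apply neq0_of_Re_pos]. }
  replace (Gamma al) with (0 + Gamma al) by ring.
  eapply ccvg_ext_from with (N := O);
    [|exact (ccvg_plus _ _ _ _ HD (inv_gauss_cvg al (Rlt_le _ _ Ha) Ha0))].
  intros n _; simpl; rewrite <- cpower_Beta_nat by assumption; ring.
Qed.

(** By [Beta_shift], [Beta al z] is [gauss (z + al) n / gauss z n] times
    [n ^ al * Beta al (z + n + 1)] for every [n]; let [n] tend to infinity. *)
Theorem Beta_Gamma (al z : C) :
  (0 < Re al)%R -> (0 < Re z)%R ->
  Beta al z = Gamma al * Gamma z * rGamma (z + al).
Proof.
  intros Ha Hz.
  pose proof (neq0_of_Re_pos z Hz) as Hz0.
  apply (ccvg_unique (fun _ => Beta al z)); [apply ccvg_const|].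
  replace (Gamma al * Gamma z * rGamma (z + al))
    with (rGamma (z + al) * Gamma z * Gamma al) by ring.
  eapply ccvg_ext_from with (N := O);
    [|exact (ccvg_mult _ _ _ _
        (ccvg_mult _ _ _ _ (gauss_cvg (z + al)) (inv_gauss_cvg z (Rlt_le _ _ Hz) Hz0))
        (cpower_Beta_cvg al z Ha Hz))].
  intros n _; simpl.
  pose proof (Beta_shift al z (S n) Ha Hz) as S.
  assert (rising z (Datatypes.S n) <> 0) as Hr by (apply rising_neq0; [lra | assumption]).
  replace (z + INR n + 1) with (z + INR (Datatypes.S n))
    by (rewrite S_INR, RtoC_plus; ring).
  unfold gauss; rewrite cpower_plus.
  pose proof (cpower_neq0 (INR n) z); pose proof (cpower_neq0 (INR n) al).
  pose proof (fact_neq0 n).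
  transitivity (rising (z + al) (Datatypes.S n) * Beta al (z + INR (Datatypes.S n))
                / rising z (Datatypes.S n)); [field; repeat split; assumption|].
  rewrite <- S; field; assumption.
Qed.

(** * Integration of a power series term by term *)

Lemma Cmod_series_tail (u : nat -> C) (b : nat -> R) (N : nat) :
  (forall n, Cmod (u n) <= b n)%R -> ex_series b ->
  (Cmod (cseries u - sum_n (G := C_AbelianMonoid) u N) <= Series b - sum_n b N)%R.
Proof.
  intros Hu Hb.
  assert (ex_series (fun n => Cmod (u n))) as Hs.
  { apply (ex_series_le (K := R_AbsRing) (V := R_CompleteNormedModule)) with b;
      [|assumption].
    intros n; change (Rabs (Cmod (u n)) <= b n)%R.
    rewrite Rabs_pos_eq by apply Cmod_ge_0; apply Hu. }
  set (s := sum_n (G := C_AbelianMonoid) u).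
  assert (ccvg (fun n => s n + - s N) (cseries u - s N)) as Hc.
  { apply ccvg_plus; [now apply ccvg_series | apply ccvg_const]. }
  apply ccvg_Cmod in Hc.
  assert (is_lim_seq (fun n => sum_n b n - sum_n b N)%R (Series b - sum_n b N)%R) as Hd.
  { apply is_lim_seq_minus'; [now apply Series_correct | apply is_lim_seq_const]. }
  assert (forall k, Cmod (s (k + N)%nat + - s N)
                      <= sum_n b (k + N) - sum_n b N)%R as Hk.
  { induction k as [|k IH].
    - simpl; replace (s N + - s N) with (RtoC 0) by ring.
      rewrite Cmod_0; lra.
    - unfold s; simpl Nat.add; rewrite !sum_Sn; unfold plus; simpl.
      fold s; replace (s (k + N)%nat + u (S (k + N)) + - s N)
        with ((s (k + N)%nat + - s N) + u (S (k + N))) by ring.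
      eapply Rle_trans; [apply Cmod_triangle|].
      pose proof (Hu (S (k + N))); lra. }
  apply (is_lim_seq_incr_n _ N) in Hc; apply (is_lim_seq_incr_n _ N) in Hd.
  exact (is_lim_seq_le _ _ _ _ Hk Hc Hd).
Qed.

Lemma CV_radius_ge_1 (a : nat -> R) :
  ex_series (fun n => Rabs (a n)) -> Rbar_le 1 (CV_radius a).
Proof.
  intros H; apply Rbar_not_lt_le; intros Hlt.
  apply (CV_disk_outside a 1); [rewrite Rabs_R1; exact Hlt|].
  apply is_lim_seq_ext with a; [intros n; rewrite pow1; ring|].
  apply ex_series_lim_0, ex_series_Rabs, H.
Qed.

Lemma pow_unit_bounds (t : R) (n : nat) : (0 < t < 1 -> 0 <= t ^ n <= 1)%R.
Proof.
  intros Ht; split; [apply pow_le; lra|].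
  rewrite <- (pow1 n); apply pow_incr; lra.
Qed.

(** Absolute summability of the coefficients gives both components a radius of
    convergence at least 1. *)
Lemma Ccontinuous_power_series (d : nat -> C) (t : R) :
  ex_series (fun n => Cmod (d n)) -> (0 < t < 1)%R ->
  Ccontinuous (fun x => cseries (fun n => d n * RtoC x ^ n)) t.
Proof.
  intros Hd Ht.
  assert (forall x, (0 < x < 1)%R ->
     cseries (fun n => d n * RtoC x ^ n)
     = (PSeries (fun n => Re (d n)) x, PSeries (fun n => Im (d n)) x)) as E.
  { intros x Hx; rewrite cseries_components.
    - apply injective_projections; apply Series_ext; intros n;
        rewrite Cpow_RtoC; simpl; unfold Re, Im; ring.
    - apply (ex_series_le (K := R_AbsRing) (V := R_CompleteNormedModule)) with (2 := Hd).
      intros n; change (Rabs (Cmod (d n * RtoC x ^ n)) <= Cmod (d n))%R.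
      rewrite Rabs_pos_eq by apply Cmod_ge_0.
      rewrite Cmod_mult, Cpow_RtoC, Cmod_R.
      destruct (pow_unit_bounds x n Hx); rewrite Rabs_pos_eq by assumption.
      pose proof (Cmod_ge_0 (d n)); nra. }
  assert (locally t (fun x => 0 < x < 1)%R) as Hloc.
  { apply (locally_interval _ t 0%R 1%R); simpl; try lra; intros; lra. }
  assert (forall a : nat -> R, ex_series (fun n => Rabs (a n)) -> continuous (PSeries a) t)
    as HP.
  { intros a Ha; apply continuity_pt_filterlim, PSeries_continuity.
    apply Rbar_lt_le_trans with 1%R; [simpl; rewrite Rabs_pos_eq; lra|].
    now apply CV_radius_ge_1. }
  split.
  - apply continuous_ext_loc with (PSeries (fun n => Re (d n))).
    { revert Hloc; apply filter_imp; intros x Hx; rewrite E by assumption; reflexivity. }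
    apply HP.
    apply (ex_series_le (K := R_AbsRing) (V := R_CompleteNormedModule)) with (2 := Hd).
    intros n; change (Rabs (Rabs (Re (d n))) <= Cmod (d n))%R.
    rewrite Rabs_Rabsolu; apply Re_le_Cmod.
  - apply continuous_ext_loc with (PSeries (fun n => Im (d n))).
    { revert Hloc; apply filter_imp; intros x Hx; rewrite E by assumption; reflexivity. }
    apply HP.
    apply (ex_series_le (K := R_AbsRing) (V := R_CompleteNormedModule)) with (2 := Hd).
    intros n; change (Rabs (Rabs (Im (d n))) <= Cmod (d n))%R.
    rewrite Rabs_Rabsolu; apply Im_le_Cmod.
Qed.

(** The remainder of the power series is at most the tail [e N] of the sum of the
    [Cmod (d n)], uniformly in [t]; hence the integral of the remainder is at most
    [e N * I]. *)
Lemma cint01_series (K : R -> C) (g : R -> R) (I : R) (d be : nat -> C) :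
  (forall t, (0 < t < 1)%R -> Ccontinuous K t) -> has_primitive g I ->
  (forall t, (0 < t < 1)%R -> Cmod (K t) <= g t)%R ->
  ex_series (fun n => Cmod (d n)) ->
  (forall n, cint01 (fun t => K t * RtoC t ^ n) (be n)) ->
  ex_series (fun n => Cmod (d n * be n)) /\
  cint01 (fun t => K t * cseries (fun n => d n * RtoC t ^ n))
    (cseries (fun n => d n * be n)).
Proof.
  intros HK Hg HKg Hd Hbe.
  set (F := fun t => cseries (fun n => d n * RtoC t ^ n)).
  assert (forall t, (0 < t < 1)%R -> 0 <= g t)%R as Hg0.
  { intros t Ht; eapply Rle_trans; [apply Cmod_ge_0 | now apply HKg]. }
  assert (forall t (n : nat), (0 < t < 1)%R -> Cmod (d n * RtoC t ^ n) <= Cmod (d n))%R as Hdt.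
  { intros t n Ht; rewrite Cmod_mult, Cpow_RtoC, Cmod_R.
    destruct (pow_unit_bounds t n Ht); rewrite Rabs_pos_eq by assumption.
    pose proof (Cmod_ge_0 (d n)); nra. }
  pose proof (is_RInt_gen_primitive g I Hg) as Ig.
  assert (forall n, Cmod (be n) <= I)%R as Hbn.
  { intros n; apply (norm_RInt_gen_le _ _ _ _ (Hbe n) Ig).
    intros t Ht; rewrite Cmod_mult, Cpow_RtoC, Cmod_R.
    destruct (pow_unit_bounds t n Ht); rewrite Rabs_pos_eq by assumption.
    pose proof (Cmod_ge_0 (K t)); pose proof (HKg t Ht); nra. }
  assert (ex_series (fun n => Cmod (d n * be n))) as Hs.
  { apply (ex_series_le (K := R_AbsRing) (V := R_CompleteNormedModule))
      with (fun n => I * Cmod (d n))%R;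
      [|now apply (ex_series_scal_l (V := R_NormedModule))].
    intros n; change (Rabs (Cmod (d n * be n)) <= I * Cmod (d n))%R.
    rewrite Rabs_pos_eq by apply Cmod_ge_0; rewrite Cmod_mult, Rmult_comm.
    apply Rmult_le_compat_r; [apply Cmod_ge_0 | apply Hbn]. }
  split; [assumption|].
  set (e := fun N => (Series (fun n => Cmod (d n)) - sum_n (fun n => Cmod (d n)) N)%R).
  assert (forall t (N : nat), (0 < t < 1)%R ->
    Cmod (F t - sum_n (G := C_AbelianMonoid) (fun n => d n * RtoC t ^ n)%C N) <= e N)%R as He.
  { intros t N Ht; apply Cmod_series_tail; [intros n; now apply Hdt | assumption]. }
  destruct (cint01_domination (fun t => K t * F t)
    (fun t => (e O + Cmod (d O)) * g t)%R ((e O + Cmod (d O)) * I)%R) as [l Hl].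
  { intros t Ht; apply Ccontinuous_mult; [now apply HK|].
    now apply Ccontinuous_power_series. }
  { now apply has_primitive_scal. }
  { intros t Ht; rewrite Cmod_mult, Rmult_comm.
    apply Rmult_le_compat; [apply Cmod_ge_0 | apply Cmod_ge_0 | | now apply HKg].
    pose proof (He t O Ht) as H; rewrite sum_O in H.
    replace (F t) with ((F t - d O * RtoC t ^ 0) + d O * RtoC t ^ 0) by ring.
    eapply Rle_trans; [apply Cmod_triangle|].
    apply Rplus_le_compat; [exact H | now apply Hdt]. }
  replace (cseries (fun n => d n * be n)) with l; [exact Hl|].
  symmetry; apply ccvg_clim, ccvg_of_Cmod.
  assert (forall N, cint01
    (fun t => K t * sum_n (G := C_AbelianMonoid) (fun n => d n * RtoC t ^ n)%C N)
    (sum_n (G := C_AbelianMonoid) (fun n => d n * be n) N)) as Hsum.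
  { assert (forall n, cint01 (fun t => K t * (d n * RtoC t ^ n)) (d n * be n)) as H1.
    { intros n; apply cint01_ext with (fun t => d n * (K t * RtoC t ^ n));
        [intros; ring | apply cint01_Cscal, Hbe]. }
    induction N as [|N IH].
    - rewrite sum_O; apply cint01_ext with (2 := H1 O); intros; now rewrite sum_O.
    - rewrite sum_Sn; apply cint01_ext with (2 := cint01_plus _ _ _ _ IH (H1 (S N))).
      intros t Ht; rewrite sum_Sn; unfold plus; simpl; ring. }
  apply is_lim_seq_le_le with (fun _ => 0%R) (fun N => e N * I)%R.
  - intros N; split; [apply Cmod_ge_0|].
    rewrite Cmod_minus_sym.
    eapply norm_RInt_gen_le;
      [exact (cint01_minus _ _ _ _ Hl (Hsum N))
      |exact (is_RInt_gen_scal (V := R_NormedModule) _ (e N) _ Ig)|].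
    intros t Ht; change (Cmod (K t * F t - K t *
      sum_n (G := C_AbelianMonoid) (fun n => d n * RtoC t ^ n)%C N) <= e N * g t)%R.
    replace (K t * F t - K t * sum_n (G := C_AbelianMonoid) (fun n => d n * RtoC t ^ n)%C N)
      with (K t * (F t - sum_n (G := C_AbelianMonoid) (fun n => d n * RtoC t ^ n)%C N)) by ring.
    rewrite Cmod_mult, Rmult_comm.
    apply Rmult_le_compat; [apply Cmod_ge_0 | apply Cmod_ge_0 | now apply He | now apply HKg].
  - apply is_lim_seq_const.
  - replace (Finite 0%R) with (Finite ((Series (fun n => Cmod (d n))
        - Series (fun n => Cmod (d n))) * I)%R) by (f_equal; ring).
    apply is_lim_seq_mult'; [|apply is_lim_seq_const].
    apply is_lim_seq_minus'; [apply is_lim_seq_const | now apply Series_correct].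
Qed.

(** * Change of variables *)

(** The substitution reverses the orientation, whence the sign of [dT]. *)
Lemma is_RInt_gen_unit_subst (T dT : R -> R) (h : R -> C) (l : C) :
  (forall x, (0 < x)%R -> (0 < T x < 1)%R) ->
  (forall x, (0 < x)%R -> is_derive T x (dT x) /\ continuous dT x) ->
  filterlim T (at_right 0) (at_left 1) ->
  filterlim T (Rbar_locally p_infty) (at_right 0) ->
  (forall t, (0 < t < 1)%R -> Ccontinuous h t) ->
  cint01 h l ->
  is_RInt_gen (V := C_R_NormedModule) (fun x => RtoC (- dT x) * h (T x))
    (at_right 0) (Rbar_locally p_infty) l.
Proof.
  intros HT HdT H1 H0 Hh Hl P HP.
  destruct (Hl P HP) as [Q R HQ HR HQR]; simpl in HQR.
  apply Filter_prod with (fun x => 0 < x /\ R (T x))%R (fun x => 0 < x /\ Q (T x))%R.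
  - apply filter_and; [|exact (H1 R HR)].
    exists (mkposreal 1 Rlt_0_1); intros; assumption.
  - apply filter_and; [|exact (H0 Q HQ)].
    exists 0%R; intros; assumption.
  - simpl; intros x1 x2 [P1 R1] [P2 Q2].
    destruct (HQR _ _ Q2 R1) as [y [Hy HPy]]; exists y; split; [|assumption].
    assert (forall x, (Rmin x1 x2 <= x <= Rmax x1 x2)%R -> (0 < x)%R) as Hpos.
    { intros x [Hx _]; eapply Rlt_le_trans; [|exact Hx]; now apply Rmin_pos. }
    pose proof (is_RInt_comp (V := C_R_CompleteNormedModule) h T dT x1 x2) as Hc.
    assert (is_RInt (V := C_R_CompleteNormedModule)
              (fun y => scal (dT y) (h (T y))) x1 x2 (opp y)) as Hs.
    { rewrite <- (is_RInt_unique (V := C_R_CompleteNormedModule) h (T x1) (T x2) (opp y)).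
      - apply Hc; intros x Hx.
        + apply Ccontinuous_continuous, Hh, HT, Hpos, Hx.
        + apply HdT, Hpos, Hx.
      - apply (is_RInt_swap (V := C_R_NormedModule)), Hy. }
    apply (is_RInt_opp (V := C_R_NormedModule)) in Hs.
    rewrite <- (opp_opp (G := C_R_NormedModule) y).
    apply (is_RInt_ext (V := C_R_NormedModule)) with (2 := Hs).
    intros x _; destruct (h (T x)) as [u v]; apply injective_projections; simpl;
      unfold opp, scal; simpl; unfold mult; simpl; ring.
Qed.

Definition oberhettinger (a x : R) : R := (x + a + sqrt (x ^ 2 + 2 * a * x))%R.

(** [w] is the larger root of [w ^ 2 - 2 (x + a) w + a ^ 2 = 0]; therefore [x] and the
    square root are rational functions of [w]. *)
Lemma oberhettinger_facts (a x : R) :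
  (0 < a)%R -> (0 < x)%R ->
  let S := sqrt (x ^ 2 + 2 * a * x) in
  let w := oberhettinger a x in
  (0 < x ^ 2 + 2 * a * x /\ 0 < S /\ a < w /\ x < w /\ S = (w * w - a * a) / (2 * w) /\
   x = (w - a) * (w - a) / (2 * w))%R.
Proof.
  intros Ha Hx S w.
  assert (0 < x ^ 2 + 2 * a * x)%R as HP by nra.
  assert (0 < S)%R as HS by now apply sqrt_lt_R0.
  assert (S * S = x ^ 2 + 2 * a * x)%R as HSS by (apply sqrt_sqrt; lra).
  assert (w = x + a + S)%R as Hw by reflexivity.
  assert (w <> 0)%R as Hw0 by lra.
  repeat split; try lra.
  - apply Rmult_eq_reg_r with (2 * w)%R; [|lra].
    unfold Rdiv; rewrite Rmult_assoc, Rinv_l, Rmult_1_r by lra.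
    rewrite Hw; nra.
  - apply Rmult_eq_reg_r with (2 * w)%R; [|lra].
    unfold Rdiv; rewrite Rmult_assoc, Rinv_l, Rmult_1_r by lra.
    rewrite Hw; nra.
Qed.

(** The substitution that rationalises the square root. *)
Definition unit_var (a x : R) : R := (a / oberhettinger a x)%R.

(** The derivative of [unit_var a], by [w' = w / S] with [S] the square root. *)
Definition unit_var' (a x : R) : R :=
  (- (a / (oberhettinger a x * sqrt (x ^ 2 + 2 * a * x))))%R.

Lemma unit_var_range (a x : R) :
  (0 < a)%R -> (0 < x)%R -> (0 < unit_var a x < 1)%R.
Proof.
  intros Ha Hx.
  destruct (oberhettinger_facts a x Ha Hx) as (_ & _ & H & _); unfold unit_var; split.
  - apply Rdiv_lt_0_compat; lra.
  - apply Rmult_lt_reg_r with (oberhettinger a x); [lra|].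
    unfold Rdiv; rewrite Rmult_assoc, Rinv_l; lra.
Qed.

Lemma is_derive_unit_var (a x : R) :
  (0 < a)%R -> (0 < x)%R ->
  is_derive (unit_var a) x (unit_var' a x) /\ continuous (unit_var' a) x.
Proof.
  intros Ha Hx.
  destruct (oberhettinger_facts a x Ha Hx) as (HP & HS & Hw & _).
  unfold oberhettinger in Hw.
  split.
  - unfold unit_var, unit_var', oberhettinger; auto_derive.
    + replace (x * (x * 1))%R with (x ^ 2)%R by ring; repeat split; lra.
    + replace (x * (x * 1))%R with (x ^ 2)%R in * by ring.
      set (S := sqrt (x ^ 2 + 2 * a * x)) in *.
      field; lra.
  - unfold unit_var', oberhettinger.
    apply (ex_derive_continuous (V := R_NormedModule)); auto_derive.
    replace (x * (x * 1))%R with (x ^ 2)%R by ring.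
    repeat split; try lra.
    apply Rmult_integral_contrapositive_currified; lra.
Qed.

Lemma filterlim_unit_var_0 (a : R) :
  (0 < a)%R -> filterlim (unit_var a) (at_right 0) (at_left 1).
Proof.
  intros Ha.
  assert (continuous (unit_var a) 0) as Hc.
  { unfold unit_var, oberhettinger.
    apply (continuous_mult (K := R_AbsRing) (fun _ => a)
      (fun x => / (x + a + sqrt (x ^ 2 + 2 * a * x)))%R); [apply continuous_const|].
    apply continuous_Rinv_comp.
    - apply (continuous_plus (V := R_NormedModule) (fun x => x + a)%R
        (fun x => sqrt (x ^ 2 + 2 * a * x))).
      + apply (ex_derive_continuous (V := R_NormedModule)); auto_derive; trivial.
      + apply continuous_sqrt_comp.
        apply (ex_derive_continuous (V := R_NormedModule)); auto_derive; trivial.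
    - replace (0 ^ 2 + 2 * a * 0)%R with 0%R by ring; rewrite sqrt_0; lra. }
  (* [unit_var a] extends continuously to 0, with value 1, since [w 0 = a]. *)
  assert (unit_var a 0 = 1)%R as E.
  { unfold unit_var, oberhettinger.
    replace (0 ^ 2 + 2 * a * 0)%R with 0%R by ring; rewrite sqrt_0; field; lra. }
  intros P HP; unfold at_left, within in HP.
  assert (locally 0%R (fun x => unit_var a x < 1 -> P (unit_var a x))%R) as H.
  { apply (Hc (fun t => (t < 1)%R -> P t)); rewrite E; exact HP. }
  destruct H as [d Hd]; exists d; intros x Hx Hx0.
  apply Hd; [assumption|]; now apply unit_var_range.
Qed.

Lemma filterlim_unit_var_infty (a : R) :
  (0 < a)%R -> filterlim (unit_var a) (Rbar_locally p_infty) (at_right 0).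
Proof.
  intros Ha P [d Hd].
  assert (0 < a / d)%R by (destruct d; apply Rdiv_lt_0_compat; assumption).
  exists (a / d)%R; intros x Hx.
  assert (0 < x)%R as Hx0 by lra.
  pose proof (unit_var_range a x Ha Hx0).
  apply Hd; [|lra].
  change (Rabs (unit_var a x - 0) < d)%R; rewrite Rminus_0_r, Rabs_pos_eq by lra.
  destruct (oberhettinger_facts a x Ha Hx0) as (_ & _ & _ & Hw & _).
  unfold unit_var; destruct d as [d Hd0]; simpl in *.
  apply Rmult_lt_reg_r with (oberhettinger a x); [lra|].
  unfold Rdiv; rewrite Rmult_assoc, Rinv_l by lra.
  apply (Rmult_lt_compat_r d) in Hx; [|assumption].
  replace (a / d * d)%R with a in Hx by (field; lra); nra.
Qed.

Lemma beta_kernel_nat (al z : C) (n : nat) (t : R) :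
  (0 < t)%R -> beta_kernel al (z + INR n) t = beta_kernel al z t * RtoC t ^ n.
Proof.
  intros Ht; unfold beta_kernel; rewrite <- cpower_nat by assumption.
  replace (z + INR n - 1) with ((z - 1) + INR n) by ring.
  rewrite cpower_plus; ring.
Qed.

(** [(1 - t) ^ (2 mu - 1) * (1 + t) * t ^ (lambda - mu - 1)], with [1 + t] expanded. *)
Definition oberhettinger_kernel (mu lambda : C) (t : R) : C :=
  beta_kernel (2 * mu) (lambda - mu) t + beta_kernel (2 * mu) (lambda - mu + 1) t.

(** With [z = lambda - mu + n], the recurrences of [Gamma] reduce both Beta values to
    the same Gamma factors, with coefficients [z + 2 mu] and [z], whose sum is
    [2 (lambda + n)]. *)
Lemma oberhettinger_kernel_moment (mu lambda : C) (n : nat) :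
  (0 < Re mu)%R -> (Re mu < Re lambda)%R ->
  cint01 (fun t => oberhettinger_kernel mu lambda t * RtoC t ^ n)
    (2 * (lambda + INR n) * Gamma (2 * mu) * Gamma (lambda - mu + INR n)
     * rGamma (1 + lambda + mu + INR n)).
Proof.
  intros Hmu Hl.
  pose proof (pos_INR n).
  assert (0 < Re (2 * mu))%R as Ha by (simpl; unfold Re in *; lra).
  assert (0 < Re (lambda - mu + INR n))%R as Hz by (simpl; unfold Re in *; lra).
  assert (0 < Re (lambda - mu + INR n + 1))%R as Hz1 by (simpl; unfold Re in *; lra).
  pose proof (cint01_plus _ _ _ _ (Beta_correct _ _ Ha Hz) (Beta_correct _ _ Ha Hz1)) as HI.
  apply cint01_ext with (g := fun t => oberhettinger_kernel mu lambda t * RtoC t ^ n) in HI.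
  2: { intros t Ht; unfold oberhettinger_kernel.
       replace (lambda - mu + INR n + 1) with (lambda - mu + 1 + INR n) by ring.
       rewrite !beta_kernel_nat by lra; ring. }
  replace (2 * (lambda + INR n) * Gamma (2 * mu) * Gamma (lambda - mu + INR n)
           * rGamma (1 + lambda + mu + INR n))
    with (Beta (2 * mu) (lambda - mu + INR n) + Beta (2 * mu) (lambda - mu + INR n + 1));
    [exact HI|].
  rewrite !Beta_Gamma by assumption.
  set (z := lambda - mu + INR n) in *.
  replace (z + 1 + 2 * mu) with (z + 2 * mu + 1) by ring.
  replace (1 + lambda + mu + INR n) with (z + 2 * mu + 1) by (unfold z; ring).
  rewrite (rGamma_step (z + 2 * mu)).
  replace (Gamma (z + 1)) with (z * Gamma z).
  - replace (lambda + INR n) with (z + mu) by (unfold z; ring); ring.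
  - unfold Gamma; rewrite (rGamma_step z).
    pose proof (neq0_of_Re_pos z Hz).
    pose proof (rGamma_neq0 (z + 1) (Rlt_le _ _ Hz1) (neq0_of_Re_pos _ Hz1)).
    field; split; assumption.
Qed.

(** Both sides are products of powers of [a / 2], [a], [1 - t] and [t]; the exponents
    are compared through [ln x = ln (a / 2) + 2 ln (1 - t) - ln t] and
    [ln w = ln a - ln t]. *)
Lemma oberhettinger_kernel_subst (a x : R) (mu lambda : C) :
  (0 < a)%R -> (0 < x)%R ->
  cpower x (mu - 1) * cpower (oberhettinger a x) (- lambda)
  = RtoC (- unit_var' a x)
    * (cpower (a / 2) mu * cpower a (- lambda) * oberhettinger_kernel mu lambda (unit_var a x)).
Proof.
  intros Ha Hx.
  pose proof (unit_var_range a x Ha Hx) as Ht.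
  destruct (oberhettinger_facts a x Ha Hx) as (HP & HS & Hw & _ & ES & EX).
  set (t := unit_var a x) in *.
  set (w := oberhettinger a x) in *.
  assert (w = a / t)%R as Ew by (unfold t, unit_var; fold w; field; lra).
  assert (- unit_var' a x = 2 * (t * t) / (a * ((1 - t) * (1 + t))))%R as Ed.
  { assert (sqrt (x ^ 2 + 2 * a * x) = a * ((1 - t) * (1 + t)) / (2 * t))%R as ES'
      by (rewrite ES, Ew; field; lra).
    unfold unit_var'; fold w; rewrite ES', Ew; field; repeat split; lra. }
  assert (x = a / 2 * ((1 - t) * (1 - t)) / t)%R as EX'.
  { rewrite EX, Ew; field; lra. }
  clearbody t w.
  assert (0 < a / 2)%R as Ha2 by lra.
  assert (0 < 1 - t)%R as Ht1 by lra.
  assert (ln x = ln (a / 2) + (ln (1 - t) + ln (1 - t)) - ln t)%R as Lx.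
  { rewrite EX', ln_div, !ln_mult; try lra; repeat apply Rmult_lt_0_compat; lra. }
  assert (ln w = ln a - ln t)%R as Lw by (rewrite Ew, ln_div; lra).
  transitivity (cpower (a / 2) (mu - 1) * cpower a (- lambda)
    * cpower (1 - t) (2 * mu - 1 - 1) * cpower t (lambda - mu + 1)).
  { unfold cpower; rewrite <- !cexp_plus; f_equal.
    rewrite Lx, Lw, !RtoC_minus, !RtoC_plus; ring. }
  unfold oberhettinger_kernel, beta_kernel; rewrite Ed.
  rewrite (cpower_pred (a / 2) mu), (cpower_pred (1 - t) (2 * mu - 1)) by assumption.
  replace (lambda - mu + 1 - 1) with (lambda - mu) by ring.
  rewrite (cpower_pred t (lambda - mu + 1)) by lra.
  replace (lambda - mu + 1 - 1) with (lambda - mu) by ring.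
  rewrite (cpower_pred t (lambda - mu)) by lra.
  assert (a * ((1 - t) * (1 + t)) <> 0)%R
    by (apply Rgt_not_eq; repeat apply Rmult_lt_0_compat; lra).
  rewrite !RtoC_div, !RtoC_mult, RtoC_minus, RtoC_plus by (assumption || lra).
  assert (RtoC a <> 0) by (apply RtoC_neq0; lra).
  assert (1 - RtoC t <> 0) by (rewrite <- RtoC_minus; apply RtoC_neq0; lra).
  assert (1 + RtoC t <> 0) by (rewrite <- RtoC_plus; apply RtoC_neq0; lra).
  field; repeat split; assumption.
Qed.

Theorem theorem1 (a : R) (y : C) (q : R) (delta lambda mu v gamma : C)
    (ha : (0 < a)%R)
    (hq : (0 < q < 1)%R \/ exists m : nat, q = INR m)
    (hdelta : (0 <= Re delta)%R)
    (hv : (-1 < Re v)%R)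
    (hgamma : (0 <= Re gamma)%R)
    (hgamma0 : gamma <> RtoC 0)
    (hdq : (Re delta - q > -1)%R)
    (hmu : (0 < Re mu)%R)
    (hmulambda : (Re mu < Re lambda)%R) :
  let w := fun x : R => (x + a + sqrt (x ^ 2 + 2 * a * x))%R in
  let num := [(gamma, RtoC q); (lambda + 1, RtoC 1); (lambda - mu, RtoC 1)] in
  let den := [(v + 1, delta); (1 + lambda + mu, RtoC 1); (lambda, RtoC 1)] in
  (* convergence of the two series involved *)
  (forall x : R, (0 < x)%R ->
     ex_series (V := C_NormedModule)
       (bessel_maitland_term v delta gamma q (y / RtoC (w x)))) /\
  ex_series (V := C_NormedModule) (wright_term num den (- (y / RtoC a))) /\
  (* convergence and value of the improper integral over (0, +oo) *)
  is_RInt_gen (V := C_R_NormedModule)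
    (fun x : R =>
       cpower x (mu - 1) * cpower (w x) (- lambda)
       * bessel_maitland v delta gamma q (y / RtoC (w x)))
    (at_right 0) (Rbar_locally p_infty)
    (Gamma (2 * mu) / Gamma gamma * cpower a (mu - lambda)
     * cpower 2 (1 - mu) * wright num den (- (y / RtoC a))).
Proof.
  intros w num den.
  assert (0 <= q)%R as hq0.
  { destruct hq as [H|[m ->]]; [lra | apply pos_INR]. }
  assert (forall z, ex_series (fun n => Cmod (bessel_maitland_term v delta gamma q z n)))
    as Hbm by (intros z; now apply bessel_maitland_abs_summable).
  split; [intros x _; apply ex_series_C, Hbm|].
  assert (RtoC a <> 0) as ha0 by (apply RtoC_neq0; lra).
  assert (0 < Re (2 * mu))%R as h2mu by (simpl; unfold Re in *; lra).
  assert (0 < Re (lambda - mu))%R as hlm by (simpl; unfold Re in *; lra).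
  assert (0 < Re (lambda - mu + 1))%R as hlm1 by (simpl; unfold Re in *; lra).
  pose proof (rGamma_neq0 gamma hgamma hgamma0) as hG.
  pose proof (rGamma_neq0 (2 * mu) (Rlt_le _ _ h2mu) (neq0_of_Re_pos _ h2mu)) as hG2.
  assert (Gamma gamma <> 0) as hGg by now apply Cinv_neq0.
  assert (Gamma (2 * mu) <> 0) as hGm by now apply Cinv_neq0.
  set (e := bessel_maitland_term v delta gamma q (y / a)).
  set (be := fun n => 2 * (lambda + INR n) * Gamma (2 * mu) * Gamma (lambda - mu + INR n)
     * rGamma (1 + lambda + mu + INR n)).
  set (W := wright_term num den (- (y / a))).
  assert (forall n, e n * be n = (2 * Gamma (2 * mu) / Gamma gamma) * W n) as HW.
  { intros n; unfold e, be, W, bessel_maitland_term, wright_term, num, den.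
    rewrite pochhammer_eq by assumption; simpl map; simpl cprod.
    simpl fst; simpl snd; rewrite !RtoC_mult, !Cmult_1_l.
    pose proof (pos_INR n).
    assert (0 < Re (lambda + 1 + INR n))%R as hl1 by (simpl; unfold Re in *; lra).
    pose proof (rGamma_neq0 _ (Rlt_le _ _ hl1) (neq0_of_Re_pos _ hl1)) as hGl.
    (* This is [lambda + n = Gamma (lambda + 1 + n) / Gamma (lambda + n)]. *)
    rewrite (rGamma_step (lambda + INR n)).
    replace (lambda + INR n + 1) with (lambda + 1 + INR n) by ring.
    replace (delta * INR n + v + 1) with (v + 1 + delta * INR n) by ring.
    pose proof (fact_neq0 n).
    assert (Gamma (lambda + 1 + INR n) = / rGamma (lambda + 1 + INR n)) as -> by reflexivity.
    field; repeat split; assumption. }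
  assert (forall n, cint01 (fun t => oberhettinger_kernel mu lambda t * RtoC t ^ n) (be n)) as Hmom
    by (intros n; now apply oberhettinger_kernel_moment).
  destruct (beta_kernel_dominated (Re (2 * mu)) (Re (lambda - mu)) h2mu hlm) as [M1 [HM1 H1]].
  destruct (beta_kernel_dominated (Re (2 * mu)) (Re (lambda - mu + 1)) h2mu hlm1)
    as [M2 [HM2 H2]].
  assert (forall t, (0 < t < 1)%R -> Ccontinuous (oberhettinger_kernel mu lambda) t) as HcK.
  { intros t Ht; apply Ccontinuous_plus; now apply Ccontinuous_beta_kernel. }
  destruct (cint01_series (oberhettinger_kernel mu lambda)
    (fun t => M1 * beta_majorant (Re (2 * mu)) (Re (lambda - mu)) t
            + M2 * beta_majorant (Re (2 * mu)) (Re (lambda - mu + 1)) t)%R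
    (M1 * (1 + 1) + M2 * (1 + 1))%R e be) as [Hs HI]; try assumption.
  { apply has_primitive_plus; now apply has_primitive_scal, has_primitive_beta_majorant. }
  { intros t Ht; unfold oberhettinger_kernel; eapply Rle_trans; [apply Cmod_triangle|].
    rewrite !Cmod_beta_kernel; apply Rplus_le_compat; [now apply H1 | now apply H2]. }
  { apply Hbm. }
  assert (ex_series (fun n => Cmod (W n))) as HsW.
  { set (c := Cmod (Gamma gamma / (2 * Gamma (2 * mu)))).
    apply (ex_series_ext (fun n => c * Cmod (e n * be n))%R).
    - intros n; unfold c; rewrite <- Cmod_mult, HW; f_equal.
      assert (RtoC 2 <> 0) by (apply RtoC_neq0; lra).
      field; repeat split; assumption.
    - now apply (ex_series_scal_l (V := R_NormedModule)). }
  split; [now apply ex_series_C|].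
  assert (cseries (fun n => e n * be n)
          = 2 * Gamma (2 * mu) / Gamma gamma * wright num den (- (y / a))) as EW.
  { rewrite (cseries_ext _ _ HW); now apply cseries_scal. }
  rewrite EW in HI.
  apply (cint01_Cscal (cpower (a / 2) mu * cpower a (- lambda))) in HI.
  apply (is_RInt_gen_unit_subst (unit_var a) (unit_var' a)) in HI.
  - replace (Gamma (2 * mu) / Gamma gamma * cpower a (mu - lambda)
             * cpower 2 (1 - mu) * wright num den (- (y / a)))
      with (cpower (a / 2) mu * cpower a (- lambda)
            * (2 * Gamma (2 * mu) / Gamma gamma * wright num den (- (y / a)))).
    (* The factor 2 of the moments turns [2 ^ (- mu)] into [2 ^ (1 - mu)]. *)
    2: { assert (cpower (a / 2) mu * cpower a (- lambda) * 2
                 = cpower a (mu - lambda) * cpower 2 (1 - mu)) as Ec.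
         { transitivity (cpower (a / 2) mu * cpower a (- lambda) * cpower 2 1);
             [rewrite (cpower_1_r 2) by lra; reflexivity|].
           unfold cpower; rewrite <- !cexp_plus; f_equal.
           rewrite ln_div, RtoC_minus by lra; ring. }
         transitivity ((cpower (a / 2) mu * cpower a (- lambda) * 2)
           * (Gamma (2 * mu) / Gamma gamma * wright num den (- (y / a))));
           [|rewrite Ec]; field; assumption. }
    revert HI; apply (is_RInt_gen_ext (V := C_R_NormedModule)
      (Fa := at_right 0) (Fb := Rbar_locally p_infty)).
    apply Filter_prod with (fun x => 0 < x)%R (fun x => 0 < x)%R.
    + exists (mkposreal 1 Rlt_0_1); intros; assumption.
    + exists 0%R; intros; assumption.
    + simpl; intros x1 x2 P1 P2 x [Hx _].
      assert (0 < x)%R as Hx0 by (eapply Rlt_trans; [|exact Hx]; now apply Rmin_pos).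
      change (w x) with (oberhettinger a x).
      rewrite oberhettinger_kernel_subst by assumption.
      assert (bessel_maitland v delta gamma q (y / oberhettinger a x)
              = cseries (fun n => e n * RtoC (unit_var a x) ^ n)) as ->.
      { apply cseries_ext; intros n; unfold e, bessel_maitland_term.
        assert (0 < oberhettinger a x)%R.
        { destruct (oberhettinger_facts a x ha Hx0) as (_ & _ & H & _); lra. }
        assert (RtoC (oberhettinger a x) <> 0) by (apply RtoC_neq0; lra).
        replace (- (y / oberhettinger a x)) with (- (y / a) * RtoC (unit_var a x)).
        - rewrite Cpow_mult_l; unfold Cdiv; ring.
        - unfold unit_var; rewrite RtoC_div by lra; field; split; assumption. }
      ring.
  - intros x Hx; now apply unit_var_range.
  - intros x Hx; now apply is_derive_unit_var.
  - now apply filterlim_unit_var_0.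
  - now apply filterlim_unit_var_infty.
  - intros t Ht; apply Ccontinuous_mult; [apply Ccontinuous_const|].
    apply Ccontinuous_mult; [now apply HcK|].
    apply Ccontinuous_power_series; [apply Hbm | assumption].
Qed.
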